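(* Let $(H,A)$ be a regular quasitriangular dual pair of Hopf algebras and $I\subseteq H^+$ a two-sided ideal of $H$. Then $H^+/I$ is a right $A$-crossed module by (the structure induced from) $$h\triangleleft a=R_2(a_{(1)})\,h\,R_1(a_{(2)}),\qquad\langle\Delta_R(h),a\rangle=\langle h,a_{(2)}\rangle\,a_{(1)}Sa_{(3)},\qquad h\in H,\ a\in A,$$ and $Q_1:A^+\to H^+/I$ gives a generalised first order bicovariant differential calculus $\Omega^1(A)=A\#(H^+/I)$. This is inner if there is a central element $\theta\in H^+$, $\theta\notin I$, such that $(\theta-1)H^+\subseteq I$. If $\theta^*\in I^\perp\subseteq A^+$ obeys $$\theta^*_{(2)}\otimes R_1(\theta^*_{(1)})R_2(\theta^*_{(3)})=\theta^*\otimes1+1\otimes Q_2(\theta^* ),$$ then $$i:H^+/I\to A^+,\qquad i(\eta)=\langle\eta,\theta^*_{(2)}\rangle\,\theta^*_{(1)}S\theta^*_{(3)}-\langle\eta,\theta^*\rangle1,\qquad\forall\eta\in H^+/I,$$ makes $\Omega^1(A)$ augmented, with Lie derivative $\mathcal{L}(a)=Q(a_{(1)},\theta^* )\,a_{(2)}-a_{(1)}\,Q(a_{(2)},\theta^* )$ for all $a\in A$.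
   Context: We work over a field $k$ of characteristic not $2$; $A^+=\ker\epsilon$, $\pi(a)=a-\epsilon(a)1$, and similarly for $H$. A quasitriangular dual pair $(H,A)$ is a nondegenerately dually paired pair of Hopf algebras with convolution-invertible maps $R_1,R_2:A\to H$, where $R_1$ is an algebra and anticoalgebra homomorphism, $R_2$ is a coalgebra and antialgebra homomorphism, and for all $h\in H$, $a,b\in A$ $$R_2(a_{(1)})h_{(1)}\langle h_{(2)},a_{(2)}\rangle=\langle h_{(1)},a_{(1)}\rangle h_{(2)}R_2(a_{(2)}),\quad h_{(1)}\langle h_{(2)},a_{(1)}\rangle R_1(a_{(2)})=R_1(a_{(1)})\langle h_{(1)},a_{(2)}\rangle h_{(2)},\quad\langle R_1(a),b\rangle=\langle a,R_2(b)\rangle.$$ Put $R(a,b)=\langle R_1(a),b\rangle$, $Q_1(a)=R_2(a_{(1)})R_1(a_{(2)})$, $Q_2(a)=R_1(a_{(1)})R_2(a_{(2)})$ and $Q(a,b)=R(b_{(1)},a_{(1)})R(a_{(2)},b_{(2)})=\langle Q_1(a),b\rangle$. The pair is regular if the right coadjoint coaction $\Delta_R(h)\in A^*\otimes A$ (with $H\subseteq A^*$), defined by $\langle\Delta_R(h),a\rangle=\langle h,a_{(2)}\rangle a_{(1)}Sa_{(3)}$, lies in $H\otimes A$ for all $h\in H$. $I^\perp=\{a\in A^+\mid\langle h,a\rangle=0\ \forall h\in I\}$. A right $A$-crossed module is a vector space $V$ with right action $\triangleleft$ and right coaction $\Delta_Rv=v_0\otimes v_1$ such that $\Delta_R(v\triangleleft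 a)=v_0\triangleleft a_{(2)}\otimes(Sa_{(1)})v_1a_{(3)}$. A generalised first order bicovariant differential calculus on $A$ is given by a right $A$-crossed module $\Lambda^1$ and a crossed module map $\omega:A^+\to\Lambda^1$, where $A^+$ has $a\triangleleft b=ab$, $\Delta_R(a)=a_{(2)}\otimes(Sa_{(1)})a_{(3)}$; it is $\Omega^1(A)=A\#\Lambda^1=A\otimes\Lambda^1$ with left multiplication, $(a\otimes v).b=ab_{(1)}\otimes v\triangleleft b_{(2)}$, left coaction $\Delta\otimes\mathrm{id}$, right coaction $a_{(1)}\otimes v_0\otimes a_{(2)}v_1$, and $\mathrm{d}a=a_{(1)}\otimes\omega(\pi(a_{(2)}))$. It is inner if $\mathrm{d}a=\theta a-a\theta$ for some $\theta\in\Omega^1$. It is augmented (at first order) by $i:\Lambda^1\to A^+$ if $i$ is a crossed module map, where now $A^+$ has $a\triangleleft b=(Sb_{(1)})ab_{(2)}$, $\Delta_Ra=\Delta a-1\otimes a$; then $i(a\otimes v)=a\,i(v)$ and on $A$ the Lie derivative is $\mathcal{L}=i\circ\mathrm{d}$. *)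

(* Defs.v *)
From HB Require Import structures.
From mathcomp Require Import all_boot all_order all_algebra generic_quotient.
From mathcomp Require Import boolp.

Set Implicit Arguments.
Unset Strict Implicit.
Unset Printing Implicit Defensive.

Import GRing.Theory.
Local Open Scope ring_scope.
Local Open Scope quotient_scope.

Reserved Notation "v ⊗ w" (at level 40, left associativity).
Reserved Notation "\tsum_ ( x , y <- t ) E"
  (at level 41, x name, y name, E at level 41,
   format "'[' \tsum_ ( x ,  y  <-  t ) '/  '  E ']'").
Reserved Notation "\tsum_ ( x , y , z <- t ) E"
  (at level 41, x name, y name, z name, E at level 41,
   format "'[' \tsum_ ( x ,  y ,  z  <-  t ) '/  '  E ']'").

Definition bilin (k : fieldType) (V W U : lmodType k) (f : V -> W -> U) : Prop :=
  (forall w, linear (f ^~ w)) /\ (forall v, linear (f v)).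

Section Tensor.
Variables (k : fieldType) (V W : lmodType k).

(* A tensor is a finite sequence of pairs, read as a sum of pure tensors; two
   of them are identified when no bilinear map into any vector space tells
   them apart.  [tsum_pure] and [tsum_linear] below give the universal
   property. *)
Definition teq (s t : seq (V * W)) : Prop :=
  forall (U : lmodType k) (f : V -> W -> U), bilin f ->
    \sum_(p <- s) f p.1 p.2 = \sum_(p <- t) f p.1 p.2.

Definition teqb : rel (seq (V * W)) := fun s t => `[< teq s t >].

Lemma teqb_equiv : equiv_class_of teqb.
Proof.
split=> [s|s t|t s u].
- by apply/asboolP.
- by apply/asboolP/asboolP => H U f bf; rewrite H.
- move=> /asboolP H1 /asboolP H2; apply/asboolP => U f bf.
  by rewrite H1 // H2.
Qed.

Canonical teqb_equivRel := EquivRelPack teqb_equiv.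
Canonical teqb_encModRel := defaultEncModRel teqb.

Definition tensor := {eq_quot teqb}.
HB.instance Definition _ : EqQuotient _ teqb tensor := EqQuotient.on tensor.
HB.instance Definition _ := Choice.on tensor.

Lemma tensor_eqP (s t : seq (V * W)) :
  (\pi_tensor s = \pi_tensor t) <-> teq s t.
Proof.
split; first by move=> /eqP; rewrite piE => /asboolP.
by move=> H; apply/eqP; rewrite piE; apply/asboolP.
Qed.

Lemma repr_teq (s : seq (V * W)) : teq (repr (\pi_tensor s)) s.
Proof. by apply/tensor_eqP; rewrite reprK. Qed.

Definition tensor_zero : tensor := \pi_tensor [::].
Definition tensor_add (x y : tensor) : tensor := \pi_tensor (repr x ++ repr y).
Definition tensor_scale (a : k) (x : tensor) : tensor :=
  \pi_tensor [seq (a *: p.1, p.2) | p <- repr x].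
Definition tensor_opp (x : tensor) : tensor := tensor_scale (-1) x.

Lemma tensor_ext (x y : tensor) : teq (repr x) (repr y) -> x = y.
Proof. by move=> /tensor_eqP; rewrite !reprK. Qed.

Lemma bilin_scale (U : lmodType k) (f : V -> W -> U) a (s : seq (V * W)) :
  bilin f ->
  \sum_(p <- [seq (a *: p.1, p.2) | p <- s]) f p.1 p.2
  = a *: \sum_(p <- s) f p.1 p.2.
Proof.
move=> [fl _]; rewrite big_map scaler_sumr; apply: eq_bigr => p _ /=.
have f0 : f 0 p.2 = 0.
  have := fl p.2 1 0 0; rewrite scaler0 addr0 scale1r => /eqP.
  by rewrite -subr_eq0 opprD addrA subrr add0r oppr_eq0 => /eqP.
by have := fl p.2 a p.1 0; rewrite addr0 f0 addr0.
Qed.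

Lemma sum_add (U : lmodType k) (f : V -> W -> U) (x y : tensor) : bilin f ->
  \sum_(p <- repr (tensor_add x y)) f p.1 p.2 =
  \sum_(p <- repr x) f p.1 p.2 + \sum_(p <- repr y) f p.1 p.2.
Proof. by move=> bf; rewrite (repr_teq _ bf) big_cat. Qed.

Lemma sum_scale (U : lmodType k) (f : V -> W -> U) a (x : tensor) : bilin f ->
  \sum_(p <- repr (tensor_scale a x)) f p.1 p.2 =
  a *: \sum_(p <- repr x) f p.1 p.2.
Proof. by move=> bf; rewrite (repr_teq _ bf) bilin_scale. Qed.

Lemma sum_zero (U : lmodType k) (f : V -> W -> U) : bilin f ->
  \sum_(p <- repr tensor_zero) f p.1 p.2 = 0.
Proof. by move=> bf; rewrite (repr_teq _ bf) big_nil. Qed.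

Fact tensor_addA : associative tensor_add.
Proof.
by move=> x y z; apply: tensor_ext => U f bf; rewrite !sum_add // addrA.
Qed.
Fact tensor_addC : commutative tensor_add.
Proof.
by move=> x y; apply: tensor_ext => U f bf; rewrite !sum_add // addrC.
Qed.
Fact tensor_add0 : left_id tensor_zero tensor_add.
Proof.
by move=> x; apply: tensor_ext => U f bf; rewrite sum_add // sum_zero // add0r.
Qed.
Fact tensor_addN : left_inverse tensor_zero tensor_opp tensor_add.
Proof.
move=> x; apply: tensor_ext => U f bf.
by rewrite sum_add // sum_zero // sum_scale // scaleN1r addNr.
Qed.
HB.instance Definition _ := GRing.isZmodule.Build tensor
  tensor_addA tensor_addC tensor_add0 tensor_addN.

Fact tensor_scaleA a b x :
  tensor_scale a (tensor_scale b x) = tensor_scale (a * b) x.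
Proof. by apply: tensor_ext => U f bf; rewrite !sum_scale // scalerA. Qed.
Fact tensor_scale1 : left_id 1 tensor_scale.
Proof. by move=> x; apply: tensor_ext => U f bf; rewrite sum_scale // scale1r. Qed.
Fact tensor_scaleDr : right_distributive tensor_scale +%R.
Proof.
move=> a x y; apply: tensor_ext => U f bf.
by rewrite sum_add // !sum_scale // sum_add // scalerDr.
Qed.
Fact tensor_scaleDl x : {morph tensor_scale^~ x : a b / a + b}.
Proof.
move=> a b; apply: tensor_ext => U f bf.
by rewrite sum_add // !sum_scale // scalerDl.
Qed.
HB.instance Definition _ := GRing.Zmodule_isLmodule.Build k tensor
  tensor_scaleA tensor_scale1 tensor_scaleDr tensor_scaleDl.

Definition tpure (v : V) (w : W) : tensor := \pi_tensor [:: (v, w)].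

(* The value at [t] of the linear map out of [V ⊗ W] induced by [f]; it is
   independent of the chosen representative as soon as [f] is bilinear. *)
Definition tsum (U : lmodType k) (f : V -> W -> U) (t : tensor) : U :=
  \sum_(p <- repr t) f p.1 p.2.

Lemma tsum_pure (U : lmodType k) (f : V -> W -> U) v w :
  bilin f -> tsum f (tpure v w) = f v w.
Proof. by move=> bf; rewrite /tsum (repr_teq _ bf) big_seq1. Qed.

Lemma tsum_linear (U : lmodType k) (f : V -> W -> U) :
  bilin f -> linear (tsum f).
Proof. by move=> bf a x y; rewrite /tsum sum_add // sum_scale. Qed.

Lemma tpure_bilin : bilin tpure.
Proof.
split=> [w a u v|v a u w]; apply: tensor_ext => U f bf;
  rewrite sum_add // sum_scale // !(repr_teq _ bf) !big_seq1 /=.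
  exact: bf.1.
exact: bf.2.
Qed.

Lemma tensor_span (t : tensor) : t = tsum tpure t.
Proof.
apply: tensor_ext => U f bf; rewrite /tsum.
elim: (repr t) => [|p s IHs]; first by rewrite !big_nil sum_zero.
by rewrite !big_cons sum_add // -IHs (repr_teq _ bf) big_seq1.
Qed.

End Tensor.

Notation "V ⊗ W" := (tensor V%type W%type) : type_scope.
Notation "v ⊗ w" := (tpure v w) : ring_scope.

(* Sweedler-type sums: [\tsum_(x, y <- t) E] is E(t', t'') summed over a
   decomposition of t; with three indices, t lies in V ⊗ (W ⊗ U). *)
Notation "\tsum_ ( x , y <- t ) E" := (tsum (fun x y => E) t) : ring_scope.
Notation "\tsum_ ( x , y , z <- t ) E" :=
  (tsum (fun x u => tsum (fun y z => E) u) t) : ring_scope.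

Section TsumTheory.
Variables (k : fieldType) (V W : lmodType k).

Lemma tsum_comp (V' W' U : lmodType k) (g : V' -> W' -> U)
    (f : V -> W -> V' ⊗ W') (t : V ⊗ W) : bilin g ->
  tsum g (tsum f t) = \tsum_(x, y <- t) tsum g (f x y).
Proof.
move=> bg; rewrite {2 3}/tsum.
pose L := GRing.isLinear.Build k _ _ _ (tsum g) (tsum_linear bg).
pose G : {linear (V' ⊗ W')%type -> U} := HB.pack (tsum g) L.
exact: (linear_sum G).
Qed.

Lemma eq_tsum (U : lmodType k) (f g : V -> W -> U) (t : V ⊗ W) :
  (forall x y, f x y = g x y) -> tsum f t = tsum g t.
Proof. by move=> fg; apply: eq_bigr => p _. Qed.

Lemma tsumB (U : lmodType k) (f g : V -> W -> U) (t : V ⊗ W) :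
  \tsum_(x, y <- t) (f x y - g x y) = tsum f t - tsum g t.
Proof. by rewrite /tsum sumrB. Qed.

Lemma linear_tsum (U U' : lmodType k) (g : {linear U -> U'}) (f : V -> W -> U)
  (t : V ⊗ W) : g (tsum f t) = \tsum_(x, y <- t) g (f x y).
Proof. exact: linear_sum. Qed.

Lemma tpureBl (v v' : V) (w : W) : (v - v') ⊗ w = v ⊗ w - v' ⊗ w.
Proof.
rewrite addrC -scaleN1r (tpure_bilin V W).1 scaleN1r addrC //.
Qed.

Lemma tpureZl a (v : V) (w : W) : (a *: v) ⊗ w = a *: (v ⊗ w).
Proof.
have z : (0 : V) ⊗ w = 0 by rewrite -(subrr 0) tpureBl subrr.
by have := (tpure_bilin V W).1 w a v 0; rewrite z !addr0.
Qed.

Lemma tpureZr a (v : V) (w : W) : v ⊗ (a *: w) = a *: (v ⊗ w).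
Proof.
have z : v ⊗ (0 : W) = 0.
  have := (tpure_bilin V W).2 v (-1) 0 0.
  by rewrite scaleN1r oppr0 addr0 scaleN1r addNr.
by have := (tpure_bilin V W).2 v a w 0; rewrite z !addr0.
Qed.

Lemma tpure_sumr (v : V) (X Y : lmodType k) (f : X -> Y -> W) (t : X ⊗ Y) :
  v ⊗ tsum f t = \tsum_(x, y <- t) v ⊗ f x y.
Proof.
pose L := GRing.isLinear.Build k _ _ _ (tpure v) ((tpure_bilin V W).2 v).
pose G : {linear W -> (V ⊗ W)%type} := HB.pack (tpure v) L.
exact: (linear_sum G).
Qed.

End TsumTheory.

Record hopfAlgType (k : fieldType) := HopfAlgType {
  hopf_alg :> algType k;
  cop : {linear hopf_alg -> (hopf_alg ⊗ hopf_alg)%type};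
  eps : {scalar hopf_alg};
  antip : {linear hopf_alg -> hopf_alg};
  copA : forall a : hopf_alg,
    \tsum_(x, y <- cop a) \tsum_(x1, x2 <- cop x) x1 ⊗ (x2 ⊗ y)
    = \tsum_(x, y <- cop a) x ⊗ cop y;
  cop_epsl : forall a : hopf_alg, \tsum_(x, y <- cop a) (eps x *: y) = a;
  cop_epsr : forall a : hopf_alg, \tsum_(x, y <- cop a) (eps y *: x) = a;
  cop1 : cop 1 = 1 ⊗ 1;
  copM : forall a b : hopf_alg, cop (a * b) =
    \tsum_(a1, a2 <- cop a) \tsum_(b1, b2 <- cop b) (a1 * b1) ⊗ (a2 * b2);
  eps1 : eps 1 = 1;
  epsM : forall a b : hopf_alg, eps (a * b) = eps a * eps b;
  antipl : forall a : hopf_alg,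
    \tsum_(x, y <- cop a) (antip x * y) = (eps a)%:A;
  antipr : forall a : hopf_alg,
    \tsum_(x, y <- cop a) (x * antip y) = (eps a)%:A
}.
Arguments cop {k h}.
Arguments eps {k h}.
Arguments antip {k h}.

(* a_(1) ⊗ a_(2) ⊗ a_(3) *)
Definition cop3 (k : fieldType) (A : hopfAlgType k) (a : A) : A ⊗ (A ⊗ A) :=
  \tsum_(x, y <- cop a) x ⊗ cop y.

Lemma cop3E (k : fieldType) (A : hopfAlgType k) (U : lmodType k)
    (f : A -> A -> A -> U) (a : A) :
  (forall y z, linear (fun x => f x y z)) -> (forall x, bilin (f x)) ->
  \tsum_(x, y, z <- cop3 a) f x y z
  = \tsum_(x, u <- cop a) \tsum_(y, z <- cop u) f x y z.
Proof.
move=> fl fb.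
have bf : bilin (fun x u => tsum (fun y z => f x y z) u).
  split=> [u c x x'|x]; last exact: tsum_linear.
  rewrite /tsum scaler_sumr -big_split /=.
  by apply: eq_bigr => p _; rewrite fl.
by rewrite /cop3 tsum_comp //; apply: eq_tsum => x u; rewrite tsum_pure.
Qed.

Section Augmentation.
Variables (k : fieldType) (A : hopfAlgType k).

Definition aug_pred : {pred A} := [pred a | eps a == 0].

Fact aug_submod_closed : submod_closed aug_pred.
Proof.
split=> [|c u v]; rewrite !inE ?raddf0 // => /eqP u0 /eqP v0.
by rewrite linearP /= u0 v0 mulr0 addr0.
Qed.
HB.instance Definition _ := GRing.isSubmodClosed.Build k A aug_pred
  (GRing.submod_closed_semi aug_submod_closed).

Record aug : Type := Aug { aug_val :> A; _ : aug_val \in aug_pred }.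
HB.instance Definition _ := [isSub for aug_val].
HB.instance Definition _ := [Choice of aug by <:].
HB.instance Definition _ := [SubChoice_isSubLmodule of aug by <:].

Fact aug_val_linear : linear aug_val.
Proof. by move=> c u v; exact: (linearP (val : aug -> A)). Qed.
HB.instance Definition _ :=
  GRing.isLinear.Build k aug A *:%R aug_val aug_val_linear.

Lemma eps_aug (a : aug) : eps (a : A) = 0.
Proof. by apply/eqP; case: a. Qed.

Fact proj_aug_subproof (a : A) : a - (eps a)%:A \in aug_pred.
Proof. by rewrite inE linearB linearZ /= eps1 mulr1 subrr. Qed.
Definition proj_aug (a : A) : aug := Aug (proj_aug_subproof a).

End Augmentation.
Arguments aug_pred {k} A.

Record dual_pairing (k : fieldType) (H A : hopfAlgType k)
    (pair : H -> A -> k) : Prop := DualPairing {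
  pair_bilin : bilin (fun h a => pair h a : k^o);
  pairM : forall (h g : H) (a : A), pair (h * g) a =
    \tsum_(a1, a2 <- cop a) (pair h a1 * pair g a2 : k^o);
  pair_cop : forall (h : H) (a b : A), pair h (a * b) =
    \tsum_(h1, h2 <- cop h) (pair h1 a * pair h2 b : k^o);
  pair1 : forall a : A, pair 1 a = eps a;
  pair_eps : forall h : H, pair h 1 = eps h;
  pair_antip : forall (h : H) (a : A), pair (antip h) a = pair h (antip a);
  pair_ndl : forall h : H, (forall a, pair h a = 0) -> h = 0;
  pair_ndr : forall a : A, (forall h, pair h a = 0) -> a = 0
}.

Definition conv_invertible (k : fieldType) (A H : hopfAlgType k)
    (f : A -> H) : Prop :=
  exists g : {linear A -> H}, forall a : A,
    \tsum_(a1, a2 <- cop a) (f a1 * g a2) = (eps a)%:A /\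
    \tsum_(a1, a2 <- cop a) (g a1 * f a2) = (eps a)%:A.

Record qtDualPair (k : fieldType) (H A : hopfAlgType k) := QtDualPair {
  pair : H -> A -> k;
  pairP : dual_pairing pair;
  R1 : {linear A -> H};
  R2 : {linear A -> H};
  R1_conv : conv_invertible R1;
  R2_conv : conv_invertible R2;
  R1_1 : R1 1 = 1;
  R1_M : forall a b : A, R1 (a * b) = R1 a * R1 b;
  R1_eps : forall a : A, eps (R1 a) = eps a;
  R1_cop : forall a : A, cop (R1 a) = \tsum_(a1, a2 <- cop a) R1 a2 ⊗ R1 a1;
  R2_1 : R2 1 = 1;
  R2_M : forall a b : A, R2 (a * b) = R2 b * R2 a;
  R2_eps : forall a : A, eps (R2 a) = eps a;
  R2_cop : forall a : A, cop (R2 a) = \tsum_(a1, a2 <- cop a) R2 a1 ⊗ R2 a2;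
  R2_comm : forall (h : H) (a : A),
    \tsum_(a1, a2 <- cop a) \tsum_(h1, h2 <- cop h)
      (pair h2 a2 *: (R2 a1 * h1))
    = \tsum_(a1, a2 <- cop a) \tsum_(h1, h2 <- cop h)
      (pair h1 a1 *: (h2 * R2 a2));
  R1_comm : forall (h : H) (a : A),
    \tsum_(a1, a2 <- cop a) \tsum_(h1, h2 <- cop h)
      (pair h2 a1 *: (h1 * R1 a2))
    = \tsum_(a1, a2 <- cop a) \tsum_(h1, h2 <- cop h)
      (pair h1 a2 *: (R1 a1 * h2));
  R1_R2 : forall a b : A, pair (R1 a) b = pair (R2 b) a
}.

Section QtDualPair.
Variables (k : fieldType) (H A : hopfAlgType k) (P : qtDualPair H A).

Definition qR (a b : A) : k := pair P (R1 P a) b.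
Definition qQ1 (a : A) : H := \tsum_(a1, a2 <- cop a) (R2 P a1 * R1 P a2).
Definition qQ2 (a : A) : H := \tsum_(a1, a2 <- cop a) (R1 P a1 * R2 P a2).
Definition qQ (a b : A) : k :=
  \tsum_(a1, a2 <- cop a) \tsum_(b1, b2 <- cop b) (qR b1 a1 * qR a2 b2 : k^o).

(* A priori a ↦ <h, a_(2)> a_(1) S a_(3) is only a linear map A -> A; it is the
   value of Delta_R on h when it comes from an element [t] of H ⊗ A, which is
   then unique by nondegeneracy. *)
Definition right_coadjoint (h : H) (t : H ⊗ A) : Prop :=
  forall a : A, \tsum_(x, y <- t) (pair P x a *: y)
    = \tsum_(a1, a2, a3 <- cop3 a) (pair P h a2 *: (a1 * antip a3)).

Definition regular_pair : Prop := forall h : H, exists t, right_coadjoint h t.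

Definition qact (h : H) (a : A) : H :=
  \tsum_(a1, a2 <- cop a) (R2 P a1 * h * R1 P a2).

Lemma eps_qact h a : eps (qact h a) = eps h * eps a.
Proof.
rewrite /qact (linear_tsum (@eps k H : {linear H -> k^o})).
rewrite -{2}(cop_epsl a) (linear_tsum (@eps k A : {linear A -> k^o})) /tsum.
rewrite mulr_sumr; apply: eq_bigr => p _ /=.
by rewrite !epsM R2_eps R1_eps linearZ /= mulrCA mulrA.
Qed.

Lemma eps_qQ1 a : eps (qQ1 a) = eps a.
Proof.
have -> : qQ1 a = qact 1 a by apply: eq_tsum => x y; rewrite mulr1.
by rewrite eps_qact eps1 mul1r.
Qed.

Fact qact_aug_subproof (h : aug H) (a : A) : qact h a \in aug_pred H.
Proof. by rewrite inE eps_qact eps_aug mul0r. Qed.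
Definition qact_aug (h : aug H) (a : A) : aug H := Aug (qact_aug_subproof h a).

Fact qQ1_aug_subproof (a : aug A) : qQ1 a \in aug_pred H.
Proof. by rewrite inE eps_qQ1 eps_aug. Qed.
Definition qQ1_aug (a : aug A) : aug H := Aug (qQ1_aug_subproof a).

End QtDualPair.

Record two_sided_ideal (k : fieldType) (H : algType k) := TwoSidedIdeal {
  ideal_pred :> {pred H};
  ideal_submod : submod_closed ideal_pred;
  idealMl : forall h x, x \in ideal_pred -> h * x \in ideal_pred;
  idealMr : forall h x, x \in ideal_pred -> x * h \in ideal_pred
}.

Section AugQuot.
Variables (k : fieldType) (H : hopfAlgType k) (I : two_sided_ideal H).

Definition ideal_in_aug : {pred aug H} := [pred x : aug H | (x : H) \in I].

Fact ideal_in_aug_closed : submod_closed ideal_in_aug.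
Proof.
have [I0 IZ] := ideal_submod I; split=> [|c u v]; rewrite !inE ?raddf0 //.
by move=> Iu Iv; rewrite linearP IZ.
Qed.
HB.instance Definition _ := GRing.isSubmodClosed.Build k (aug H) ideal_in_aug
  (GRing.submod_closed_semi ideal_in_aug_closed).

Definition aug_quot : Type := Quotient.quot ideal_in_aug.
HB.instance Definition _ := GRing.Zmodule.on aug_quot.

Definition aug_pi (h : aug H) : aug_quot := \pi_(Quotient.quot ideal_in_aug) h.

Lemma aug_pi_eq (h g : aug H) :
  aug_pi h = aug_pi g <-> (h : H) - (g : H) \in I.
Proof.
rewrite -raddfB -[_ \in I]/(h - g \in ideal_in_aug) Quotient.idealrBE.
by split=> [H0|/eqP //]; apply/eqP.
Qed.

Lemma aug_piD : {morph aug_pi : h g / h + g}.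
Proof. by move=> h g; rewrite /aug_pi raddfD. Qed.

Lemma aug_pi_repr (x : aug_quot) : aug_pi (repr x) = x.
Proof. exact: reprK. Qed.

Definition aug_quot_scale (c : k) (x : aug_quot) : aug_quot :=
  aug_pi (c *: repr x).

Lemma aug_piZ c h : aug_pi (c *: h) = aug_quot_scale c (aug_pi h).
Proof.
apply/aug_pi_eq; rewrite -raddfB -scalerBr.
have : aug_pi h = aug_pi (repr (aug_pi h)) by rewrite aug_pi_repr.
move=> /aug_pi_eq; rewrite -raddfB => Ih.
have [I0 IZ] := ideal_in_aug_closed.
by have := IZ c _ _ Ih I0; rewrite addr0.
Qed.

Fact aug_quot_scaleA a b x :
  aug_quot_scale a (aug_quot_scale b x) = aug_quot_scale (a * b) x.
Proof. by rewrite -(aug_pi_repr x) -!aug_piZ scalerA. Qed.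
Fact aug_quot_scale1 : left_id 1 aug_quot_scale.
Proof. by move=> x; rewrite -(aug_pi_repr x) -aug_piZ scale1r. Qed.
Fact aug_quot_scaleDr : right_distributive aug_quot_scale +%R.
Proof.
move=> a x y; rewrite -(aug_pi_repr x) -(aug_pi_repr y).
by rewrite -aug_piD -!aug_piZ -aug_piD scalerDr.
Qed.
Fact aug_quot_scaleDl x : {morph aug_quot_scale^~ x : a b / a + b}.
Proof.
by move=> a b; rewrite -(aug_pi_repr x) -!aug_piZ -aug_piD scalerDl.
Qed.
HB.instance Definition _ := GRing.Zmodule_isLmodule.Build k aug_quot
  aug_quot_scaleA aug_quot_scale1 aug_quot_scaleDr aug_quot_scaleDl.

Lemma aug_pi_linear : linear aug_pi.
Proof. by move=> c x y; rewrite aug_piD aug_piZ. Qed.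

End AugQuot.

Definition perp (k : fieldType) (H A : hopfAlgType k) (P : qtDualPair H A)
    (I : two_sided_ideal H) (a : A) : Prop :=
  a \in aug_pred A /\ forall h : H, h \in I -> pair P h a = 0.

Record crossedData (k : fieldType) (A : hopfAlgType k) (V : lmodType k) :=
  CrossedData { act : V -> A -> V; coact : V -> V ⊗ A }.

Section Crossed.
Variables (k : fieldType) (A : hopfAlgType k).

Record crossed_module (V : lmodType k) (X : crossedData A V) : Prop :=
  CrossedModule {
  act_bilin : bilin (act X);
  act1 : forall v, act X v 1 = v;
  actM : forall v a b, act X v (a * b) = act X (act X v a) b;
  coact_linear : linear (coact X);
  coact_eps : forall v, \tsum_(x, y <- coact X v) (eps y *: x) = v;
  coactA : forall v,
    \tsum_(x, y <- coact X v) \tsum_(x0, x1 <- coact X x) x0 ⊗ (x1 ⊗ y)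
    = \tsum_(x, y <- coact X v) x ⊗ cop y;
  coact_act : forall v a, coact X (act X v a) =
    \tsum_(v0, v1 <- coact X v) \tsum_(a1, a2, a3 <- cop3 a)
      act X v0 a2 ⊗ (antip a1 * v1 * a3)
}.

Definition crossed_map (V W : lmodType k) (X : crossedData A V)
    (Y : crossedData A W) (f : V -> W) : Prop :=
  [/\ linear f,
      forall v a, f (act X v a) = act Y (f v) a &
      forall v, coact Y (f v) = \tsum_(x, y <- coact X v) f x ⊗ y].

(* A^+ with a ◁ b = ab and a ↦ a_(2) ⊗ (S a_(1)) a_(3). The projection to A^+
   serves to land in A^+ ⊗ A: see [aug_mul_coactE]. *)
Fact aug_mul_subproof (a : aug A) (b : A) : (a : A) * b \in aug_pred A.
Proof. by rewrite inE epsM eps_aug mul0r. Qed.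

Definition aug_mul : crossedData A (aug A) := {|
  act := fun a b => Aug (aug_mul_subproof a b);
  coact := fun a =>
    \tsum_(a1, a2, a3 <- cop3 (a : A)) proj_aug a2 ⊗ (antip a1 * a3)
|}.

(* A^+ with a ◁ b = (S b_(1)) a b_(2) and a ↦ Delta a - 1 ⊗ a: see
   [aug_ad_coactE]. *)
Fact aug_ad_subproof (a : aug A) (b : A) :
  \tsum_(b1, b2 <- cop b) (antip b1 * (a : A) * b2) \in aug_pred A.
Proof.
rewrite inE (linear_tsum (@eps k A : {linear A -> k^o})) /tsum big1 // => p _.
by rewrite /= !epsM eps_aug mulr0 mul0r.
Qed.

Definition aug_ad : crossedData A (aug A) := {|
  act := fun a b => Aug (aug_ad_subproof a b);
  coact := fun a => \tsum_(a1, a2 <- cop (a : A)) proj_aug a1 ⊗ a2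
|}.

Lemma val_bilin : bilin (fun (x : aug A) (y : A) => aug_val x ⊗ y).
Proof.
by split=> [w c u v|v c u w] /=; rewrite ?linearP;
   [apply: (tpure_bilin A A).1 | apply: (tpure_bilin A A).2].
Qed.

Lemma aug_ad_coactE (a : aug A) :
  \tsum_(x, y <- coact aug_ad a) aug_val x ⊗ y = cop (a : A) - 1 ⊗ (a : A).
Proof.
rewrite (tsum_comp _ _ val_bilin) [in RHS](tensor_span (cop (a : A))).
rewrite -[in X in _ - _ ⊗ X](cop_epsl (a : A)).
have -> : (1 : A) ⊗ (\tsum_(x, y <- cop (a : A)) (eps x *: y))
    = \tsum_(x, y <- cop (a : A)) ((eps x)%:A ⊗ y).
  by rewrite tpure_sumr; apply: eq_tsum => x y; rewrite tpureZl tpureZr.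
rewrite -tsumB; apply: eq_tsum => x y.
by rewrite (tsum_pure _ _ val_bilin) /= tpureBl.
Qed.

Lemma aug_mul_coactE (a : aug A) :
  \tsum_(x, y <- coact aug_mul a) aug_val x ⊗ y
  = \tsum_(a1, a2, a3 <- cop3 (a : A)) a2 ⊗ (antip a1 * a3).
Proof.
have lin1 (v : A) : linear (@tpure k A A v) by exact: (tpure_bilin A A).2.
have lin2 (v : aug A) : linear (@tpure k _ A v) by exact: (tpure_bilin _ A).2.
have linp : linear (@proj_aug k A).
  move=> c u v; apply: val_inj => /=.
  rewrite (linearP (@eps k A)).
  rewrite [RHS](_ : _ = c *: (u - (eps u)%:A) + (v - (eps v)%:A)) //.
  by rewrite scalerBr scalerA addrACA -opprD -scalerDl.
have linm (z : A) : linear (fun x : A => antip x * z).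
  by move=> c u v; rewrite linearP mulrDl scalerAl.
have linm' (x : A) : linear (fun z : A => antip x * z).
  by move=> c u v; rewrite mulrDr scalerAr.
have tmul (b : A) (f : A -> A -> A) u :
  b * tsum f u = \tsum_(y, z <- u) (b * f y z) by exact: mulr_sumr.
rewrite /= !cop3E.
- rewrite tsum_comp; last exact: val_bilin.
  rewrite (eq_tsum (g := fun x u => (\tsum_(y, z <- cop u) y ⊗ (antip x * z))
      - (1 : A) ⊗ (antip x * u))); last first.
    move=> x u; rewrite tsum_comp; last exact: val_bilin.
    rewrite -[in X in _ - _ ⊗ (_ * X)](cop_epsl u).
    rewrite tmul tpure_sumr -tsumB; apply: eq_tsum => y z.
    rewrite tsum_pure; last exact: val_bilin.
    by rewrite /= tpureBl tpureZl -scalerAr tpureZr.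
  rewrite tsumB -tpure_sumr antipl eps_aug scale0r.
  by rewrite -[X in _ ⊗ X](scale0r 0) tpureZr scale0r subr0.
- by move=> y z c u v; rewrite linm lin1.
- move=> x; split=> [w c u v|v c u w]; first exact: (tpure_bilin A A).1.
  by rewrite linm' lin1.
- by move=> y z c u v; rewrite linm lin2.
- move=> x; split=> [w c u v|v c u w].
    by rewrite linp (tpure_bilin _ A).1.
  by rewrite linm' lin2.
Qed.

End Crossed.

Section Calculus.
Variables (k : fieldType) (A : hopfAlgType k) (V : lmodType k).
Variables (X : crossedData A V) (w : aug A -> V).

Definition gen_calculus : Prop := crossed_module X /\ crossed_map (aug_mul A) X w.

Definition om_lmul (a : A) (t : A ⊗ V) : A ⊗ V :=
  \tsum_(b, v <- t) (a * b) ⊗ v.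
Definition om_rmul (t : A ⊗ V) (b : A) : A ⊗ V :=
  \tsum_(a, v <- t) \tsum_(b1, b2 <- cop b) (a * b1) ⊗ act X v b2.
Definition om_lcoact (t : A ⊗ V) : A ⊗ (A ⊗ V) :=
  \tsum_(a, v <- t) \tsum_(a1, a2 <- cop a) a1 ⊗ (a2 ⊗ v).
Definition om_rcoact (t : A ⊗ V) : (A ⊗ V) ⊗ A :=
  \tsum_(a, v <- t) \tsum_(a1, a2 <- cop a) \tsum_(v0, v1 <- coact X v)
    (a1 ⊗ v0) ⊗ (a2 * v1).
Definition om_d (a : A) : A ⊗ V :=
  \tsum_(a1, a2 <- cop a) a1 ⊗ w (proj_aug a2).

Definition inner_calculus : Prop :=
  exists th : A ⊗ V, forall a : A, om_d a = om_rmul th a - om_lmul a th.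

Definition augmented_by (i : V -> aug A) : Prop := crossed_map X (aug_ad A) i.

Definition om_i (i : V -> aug A) (t : A ⊗ V) : A :=
  \tsum_(a, v <- t) (a * (i v : A)).

Definition lie_derivative (i : V -> aug A) (a : A) : A := om_i i (om_d a).

End Calculus.

Definition induced_crossed (k : fieldType) (H A : hopfAlgType k)
    (P : qtDualPair H A) (I : two_sided_ideal H)
    (X : crossedData A (aug_quot I)) : Prop :=
  (forall (h : aug H) (a : A),
     act X (aug_pi I h) a = aug_pi I (qact_aug P h a)) /\
  (forall h : aug H, exists t : aug H ⊗ A,
     right_coadjoint P h (\tsum_(x, y <- t) aug_val x ⊗ y) /\
     coact X (aug_pi I h) = \tsum_(x, y <- t) aug_pi I x ⊗ y).

(* Main.v *)
From HB Require Import structures.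
Require Import Defs.
From mathcomp Require Import all_boot all_order all_algebra.
From mathcomp Require Import ring boolp.
Import GRing.Theory.
Local Open Scope ring_scope.

(* Since H separates the points of A, a right A-coaction on V is determined by
   the left H-action g . v = <g, v_1> v_0, and the coaction of the theorem is the
   one with g . h = g_1 h S(g_2).  Every axiom then becomes an identity in H, and
   the only substantial one is
     g . (h <| a) = <S g_1, a_1> (g_2 . h) <| a_2 <g_3, a_3>,
   which follows by moving g past R_2 and R_1 with the two exchange relations of
   the dual pair.  Taking h = 1 gives the covariance of Q_1.  The augmentation is
   characterised by <g, i(h)> = <g . h, theta^*> - eps(g) <h, theta^*>, so that it
   is compatible with the action as soon as <h <| a, theta^*> = <h, theta^*> eps(a)
   for h in H^+; this is what the condition on theta^* says once its first leg is
   paired with h and its second with a. *)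

Set Implicit Arguments.
Unset Strict Implicit.
Unset Printing Implicit Defensive.

(** * Linear and bilinear maps *)

Section Linearity.
Variable k : fieldType.
Implicit Types U V W X : lmodType k.

Lemma lin_id V : linear (fun x : V => x).
Proof. by []. Qed.

Lemma lin_comp U V W (g : {linear V -> W}) (f : U -> V) :
  linear f -> linear (fun x => g (f x)).
Proof. by move=> lf c u v; rewrite lf linearP. Qed.

Lemma lin_fun U V W (g : V -> W) (f : U -> V) :
  linear g -> linear f -> linear (fun x => g (f x)).
Proof. by move=> lg lf c u v; rewrite lf lg. Qed.

Lemma lin_eps U (A : hopfAlgType k) (f : U -> A) :
  linear f -> linear (fun x => eps (f x) : k^o).
Proof. by move=> lf c u v; rewrite lf linearP. Qed.

Lemma lin_add U V (f g : U -> V) :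
  linear f -> linear g -> linear (fun x => f x + g x).
Proof. by move=> lf lg c u v; rewrite lf lg scalerDr addrACA. Qed.

Lemma lin_opp U V (f : U -> V) : linear f -> linear (fun x => - f x).
Proof. by move=> lf c u v; rewrite lf opprD scalerN. Qed.

(* The variants for scalar-valued maps below restate the general lemmas because
   the module [k^o] cannot be recovered by unification from its carrier [k]. *)
Lemma lin_sadd U (f g : U -> k^o) :
  linear f -> linear g -> linear (fun x => f x + g x).
Proof. exact: lin_add. Qed.

Lemma lin_sopp U (f : U -> k^o) : linear f -> linear (fun x => - f x).
Proof. exact: lin_opp. Qed.

Lemma lin_mull U (A : algType k) (b : A) (f : U -> A) :
  linear f -> linear (fun x => f x * b).
Proof. by move=> lf c u v; rewrite lf mulrDl scalerAl. Qed.

Lemma lin_mulr U (A : algType k) (b : A) (f : U -> A) :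
  linear f -> linear (fun x => b * f x).
Proof. by move=> lf c u v; rewrite lf mulrDr scalerAr. Qed.

Lemma lin_smull U (b : k) (f : U -> k^o) :
  linear f -> linear (fun x => f x * b : k^o).
Proof. exact: lin_mull. Qed.

Lemma lin_smulr U (b : k) (f : U -> k^o) :
  linear f -> linear (fun x => b * f x : k^o).
Proof. exact: lin_mulr. Qed.

Lemma lin_scalel U V (v : V) (f : U -> k^o) :
  linear f -> linear (fun x => (f x : k) *: v).
Proof. by move=> lf c x y; rewrite lf scalerDl -scalerA. Qed.

Lemma lin_scaler U V (a : k) (f : U -> V) :
  linear f -> linear (fun x => a *: f x).
Proof. by move=> lf c x y; rewrite lf scalerDr !scalerA mulrC. Qed.

Lemma lin_sscalel U (v : k^o) (f : U -> k^o) :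
  linear f -> linear (fun x => (f x : k) *: v).
Proof. exact: lin_scalel. Qed.

Lemma lin_sscaler U (a : k) (f : U -> k^o) :
  linear f -> linear (fun x => a *: f x).
Proof. exact: lin_scaler. Qed.

Lemma lin_tpurel U V W (w : W) (f : U -> V) :
  linear f -> linear (fun x => f x ⊗ w).
Proof. by move=> lf c x y; rewrite lf (tpure_bilin V W).1. Qed.

Lemma lin_tpurer U V W (v : V) (f : U -> W) :
  linear f -> linear (fun x => v ⊗ f x).
Proof. by move=> lf c x y; rewrite lf (tpure_bilin V W).2. Qed.

Lemma lin_tsum U V W X (f : X -> V -> W -> U) (t : V ⊗ W) :
  (forall v w, linear (fun x => f x v w)) -> linear (fun x => tsum (f x) t).
Proof.
move=> lf c x y; rewrite /tsum scaler_sumr -big_split /=.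
by apply: eq_bigr => p _; rewrite lf.
Qed.

Lemma lin_tsum_arg U V W X (f : V -> W -> U) (t : X -> V ⊗ W) :
  bilin f -> linear t -> linear (fun x => tsum f (t x)).
Proof. by move=> bf lt c x y; rewrite lt tsum_linear. Qed.

Lemma lin0 V U (f : V -> U) : linear f -> f 0 = 0.
Proof.
move=> lf; have := lf (-1) 0 0.
by rewrite scaler0 add0r scaleN1r addNr.
Qed.

Lemma linZ V U (f : V -> U) c x : linear f -> f (c *: x) = c *: f x.
Proof. by move=> lf; rewrite -[c *: x]addr0 lf lin0 // addr0. Qed.

Lemma linB V U (f : V -> U) x y : linear f -> f (x - y) = f x - f y.
Proof. by move=> lf; rewrite addrC -scaleN1r lf scaleN1r addrC. Qed.

Lemma lin_sum V U (J : Type) (r : seq J) (F : J -> V) (f : V -> U) :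
  linear f -> f (\sum_(p <- r) F p) = \sum_(p <- r) f (F p).
Proof.
move=> lf; apply: (big_morph f); last exact: lin0.
by move=> x y; have := lf 1 x y; rewrite !scale1r.
Qed.

Lemma tsumZ V W U c (f : V -> W -> U) t :
  c *: tsum f t = \tsum_(x, y <- t) (c *: f x y).
Proof. exact: scaler_sumr. Qed.

Lemma tsum_mull V W (B : algType k) (F : V -> W -> B) t c :
  tsum F t * c = \tsum_(x, y <- t) (F x y * c).
Proof. exact: mulr_suml. Qed.

Lemma tsum_mulr V W (B : algType k) (F : V -> W -> B) t c :
  c * tsum F t = \tsum_(x, y <- t) (c * F x y).
Proof. exact: mulr_sumr. Qed.

End Linearity.

Section AugLinear.
Variables (k : fieldType) (H : hopfAlgType k).

Lemma lin_aug (U : lmodType k) (f : U -> aug H) :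
  linear (fun x => aug_val (f x)) -> linear f.
Proof.
move=> lf c u v; apply: val_inj.
exact: etrans (lf c u v) (esym (aug_val_linear c (f u) (f v))).
Qed.

Lemma lin_val (U : lmodType k) (f : U -> aug H) :
  linear f -> linear (fun x => aug_val (f x)).
Proof.
move=> lf c u v.
exact: etrans (congr1 _ (lf c u v)) (aug_val_linear c (f u) (f v)).
Qed.

Lemma lin_aug_pi (I : two_sided_ideal H) (U : lmodType k) (f : U -> aug H) :
  linear f -> linear (fun x => aug_pi I (f x)).
Proof. by move=> lf c u v; rewrite lf aug_pi_linear. Qed.

End AugLinear.

(** * Translation, adjoint and coaction-induced actions of [H] *)

Section Actions.
Variables (k : fieldType) (H A : hopfAlgType k) (P : qtDualPair H A).
Implicit Types (g h : H) (a : A).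

Local Notation "⟨ h , a ⟩" := (pair P h a)
  (at level 0, h at level 99, format "⟨ h ,  a ⟩").

Lemma lin_pairl (U : lmodType k) (f : U -> H) a : linear f ->
  linear (fun x => ⟨f x, a⟩ : k^o).
Proof. exact: (@lin_fun _ _ _ k^o ((pair P)^~ a) f ((pair_bilin (pairP P)).1 a)). Qed.

Lemma lin_pairr (U : lmodType k) h (f : U -> A) : linear f ->
  linear (fun x => ⟨h, f x⟩ : k^o).
Proof. exact: (@lin_fun _ _ _ k^o (pair P h) f ((pair_bilin (pairP P)).2 h)). Qed.

(** [hitl] and [hitr] are the transposes of left and right multiplication by [g] in [H]; with them
    the exchange relations can be written with sums over the coproduct of [H] only. *)
Definition hitl g a : A := \tsum_(x, y <- cop a) (⟨g, x⟩ *: y).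
Definition hitr g a : A := \tsum_(x, y <- cop a) (⟨g, y⟩ *: x).

Definition adact g h : H := \tsum_(x, y <- cop g) (x * h * antip y).

Fact adact_aug_subproof g (h : aug H) : adact g h \in aug_pred H.
Proof.
rewrite inE (linear_tsum (@eps k H : {linear H -> k^o})) /tsum big1 // => p _.
by rewrite /= !epsM eps_aug mulr0 mul0r.
Qed.
Definition adact_aug g (h : aug H) : aug H := Aug (adact_aug_subproof g h).

(** When [t] is the coaction of a vector, this is the left action of [g] on that vector. *)
Definition teval (V : lmodType k) g (t : V ⊗ A) : V := \tsum_(v, a <- t) (⟨g, a⟩ *: v).

End Actions.

(** * Automated linearity, by recursion on the expression *)

Definition trilin (k : fieldType) (V1 V2 V3 U : lmodType k) (f : V1 -> V2 -> V3 -> U) :=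
  (forall y z, linear (fun x => f x y z)) /\ (forall x, bilin (f x)).

(* In the clauses for bilinear operations, matching against [fun _ => ?c] decides
   which of the two arguments is independent of the variable. *)
Ltac lin_hyp :=
  lazymatch goal with
  | B : bilin ?F |- GRing.linear_for _ (fun x => ?F (@?u x) (@?v x)) =>
      first [ lazymatch v with fun _ => ?c =>
                refine (@lin_fun _ _ _ _ (F ^~ c) u (B.1 c) _) end
            | lazymatch u with fun _ => ?c =>
                refine (@lin_fun _ _ _ _ (F c) v (B.2 c) _) end ]; lin
  | B : bilin ?F |- GRing.linear_for _ (?F ?c) => exact: (B.2 c)
  | L : GRing.linear_for _ ?F |- GRing.linear_for _ (fun x => ?F (@?u x)) =>
      refine (@lin_fun _ _ _ _ F u L _); lin
  end
with lin := cbv beta;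
  lazymatch goal with
  | |- bilin _ => split; cbv beta; lin
  | |- trilin _ => split; cbv beta; lin
  | |- GRing.linear_for _ (fun x => x) => exact: lin_id
  | |- GRing.linear_for _ (fun x => @tsum _ _ _ ?U (@?f x) (@?t x)) =>
      first [ lazymatch t with fun _ => ?c =>
                refine (@lin_tsum _ U _ _ _ f c _); cbv beta; intros end
            | lazymatch f with fun _ => ?c =>
                refine (@lin_tsum_arg _ U _ _ _ c t _ _) end ]; lin
  | |- GRing.linear_for _ (fun x => @?f x ⊗ @?g x) =>
      first [ lazymatch g with fun _ => ?c => refine (@lin_tpurel _ _ _ _ c f _) end
            | lazymatch f with fun _ => ?c => refine (@lin_tpurer _ _ _ _ c g _) end ]; lin
  | |- GRing.linear_for _ (fun x => @GRing.mul _ (@?f x) (@?g x)) =>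
      first [ lazymatch g with fun _ => ?c =>
                first [ refine (@lin_mull _ _ _ c f _)
                      | refine (@lin_smull _ _ c f _) ] end
            | lazymatch f with fun _ => ?c =>
                first [ refine (@lin_mulr _ _ _ c g _)
                      | refine (@lin_smulr _ _ c g _) ] end ]; lin
  | |- GRing.linear_for _ (fun x => @?f x *: @?g x) =>
      first [ lazymatch g with fun _ => ?c =>
                first [ refine (@lin_scalel _ _ _ c f _)
                      | refine (@lin_sscalel _ _ c f _) ] end
            | lazymatch f with fun _ => ?c =>
                first [ refine (@lin_scaler _ _ _ c g _)
                      | refine (@lin_sscaler _ _ c g _) ] end ]; lin
  | |- GRing.linear_for _ (fun x => @?f x + @?g x) =>
      first [ refine (@lin_add _ _ _ f g _ _) | refine (@lin_sadd _ _ f g _ _) ]; lin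
  | |- GRing.linear_for _ (fun x => - @?f x) =>
      first [ refine (@lin_opp _ _ _ f _) | refine (@lin_sopp _ _ f _) ]; lin
  | |- GRing.linear_for _ (fun x => GRing.Linear.sort eps (@?f x)) =>
      refine (@lin_eps _ _ _ f _); lin
  | |- GRing.linear_for _ (fun x => GRing.Linear.sort ?g (@?f x)) =>
      refine (@lin_comp _ _ _ _ g f _); lin
  | |- GRing.linear_for _ _ =>
      first [ lin_extra | lin_hyp | assumption ]
  | |- forall x, _ => intro; lin
  end
with lin_extra :=
  lazymatch goal with
  | |- GRing.linear_for _ (fun x => pair ?P (@?g x) (@?f x)) =>
      first [ lazymatch f with fun _ => ?c => refine (@lin_pairl _ _ _ P _ g c _) end
            | lazymatch g with fun _ => ?c => refine (@lin_pairr _ _ _ P _ c f _) end ]; lin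
  | |- GRing.linear_for _ (fun x => hitl _ _ _) => rewrite /hitl; lin
  | |- GRing.linear_for _ (fun x => hitr _ _ _) => rewrite /hitr; lin
  | |- GRing.linear_for _ (fun x => qact _ _ _) => rewrite /qact; lin
  | |- GRing.linear_for _ (fun x => qQ1 _ _) => rewrite /qQ1; lin
  | |- GRing.linear_for _ (fun x => adact _ _) => rewrite /adact; lin
  | |- GRing.linear_for _ (fun x => teval _ _ _) => rewrite /teval; lin
  | |- GRing.linear_for _ (fun x => aug_val (proj_aug _)) => rewrite /=; lin
  | |- GRing.linear_for _ (fun x => aug_val (qact_aug _ _ _)) => rewrite /=; lin
  | |- GRing.linear_for _ (fun x => aug_val (qQ1_aug _ _)) => rewrite /=; lin
  | |- GRing.linear_for _ (fun x => aug_val (adact_aug _ _)) => rewrite /=; lin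
  | |- GRing.linear_for _ (fun x => aug_val (@?f x)) => refine (@lin_val _ _ _ f _); lin
  | |- GRing.linear_for _ (fun x => proj_aug _) => apply: lin_aug; lin
  | |- GRing.linear_for _ (fun x => qact_aug _ _ _) => apply: lin_aug; lin
  | |- GRing.linear_for _ (fun x => qQ1_aug _ _) => apply: lin_aug; lin
  | |- GRing.linear_for _ (fun x => adact_aug _ _) => apply: lin_aug; lin
  | |- GRing.linear_for _ (fun x => aug_pi ?I (@?f x)) =>
      refine (@lin_aug_pi _ _ I _ f _); lin
  end.

Ltac tsum_ext x y :=
  lazymatch goal with
  | |- @eq _ (@tsum ?k ?V ?W ?U ?f ?t) (@tsum _ _ _ _ ?g _) =>
      refine (@eq_tsum k V W U f g t _) => x y
  end.

(** * Sweedler calculus *)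

Section Sweedler.
Variables (k : fieldType).

Lemma exchange_tsum (V W V' W' U : lmodType k) (f : V -> W -> V' -> W' -> U) s t :
  \tsum_(x, y <- s) \tsum_(x', y' <- t) f x y x' y'
  = \tsum_(x', y' <- t) \tsum_(x, y <- s) f x y x' y'.
Proof. exact: exchange_big. Qed.

Lemma tsum_lin (V W U U' : lmodType k) (g : U -> U') (f : V -> W -> U) t :
  linear g -> g (tsum f t) = \tsum_(x, y <- t) g (f x y).
Proof.
move=> lg; pose L := GRing.isLinear.Build k U U' _ g lg.
pose G : {linear U -> U'} := HB.pack g L.
exact: (linear_tsum G).
Qed.

Variable A : hopfAlgType k.

(** A trilinear [f] factors through [A ⊗ (A ⊗ A)], where [copA] identifies the two iterated
    coproducts. *)
Lemma tsumA (U : lmodType k) (f : A -> A -> A -> U) (a : A) : trilin f ->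
  \tsum_(x, y <- cop a) \tsum_(x1, x2 <- cop x) f x1 x2 y
  = \tsum_(x, y <- cop a) \tsum_(y1, y2 <- cop y) f x y1 y2.
Proof.
case=> f1 f2.
have bf : bilin (fun x u => tsum (f x) u).
  split; last by move=> x; apply: tsum_linear.
  by move=> w; apply: lin_tsum => *; apply: f1.
transitivity (\tsum_(x, y, z <-
    \tsum_(x, y <- cop a) \tsum_(x1, x2 <- cop x) x1 ⊗ (x2 ⊗ y)) f x y z).
  rewrite tsum_comp //; apply: eq_tsum => x y.
  rewrite tsum_comp //; apply: eq_tsum => x1 x2.
  by rewrite tsum_pure // tsum_pure.
rewrite copA tsum_comp //; apply: eq_tsum => x y.
by rewrite tsum_pure.
Qed.

Lemma tsum_epsl (U : lmodType k) (f : A -> U) a : linear f ->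
  \tsum_(x, y <- cop a) (eps x *: f y) = f a.
Proof.
move=> lf; rewrite -[in RHS](cop_epsl a) (tsum_lin _ _ lf).
by apply: eq_tsum => x y; rewrite linZ.
Qed.

Lemma tsum_epsr (U : lmodType k) (f : A -> U) a : linear f ->
  \tsum_(x, y <- cop a) (eps y *: f x) = f a.
Proof.
move=> lf; rewrite -[in RHS](cop_epsr a) (tsum_lin _ _ lf).
by apply: eq_tsum => x y; rewrite linZ.
Qed.

Lemma tsum_antipl (U : lmodType k) (f : A -> U) a : linear f ->
  \tsum_(x, y <- cop a) f (antip x * y) = eps a *: f 1.
Proof. by move=> lf; rewrite -(tsum_lin _ _ lf) antipl linZ. Qed.

Lemma tsum_antipr (U : lmodType k) (f : A -> U) a : linear f ->
  \tsum_(x, y <- cop a) f (x * antip y) = eps a *: f 1.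
Proof. by move=> lf; rewrite -(tsum_lin _ _ lf) antipr linZ. Qed.

(** Coassociativity moves the split to the first leg; the antipode axiom then leaves a counit, which
    is absorbed. *)
Lemma antip_cancell (U : lmodType k) (f : A -> A -> U) a : bilin f ->
  \tsum_(x, y <- cop a) \tsum_(y1, y2 <- cop y) f (antip x * y1) y2 = f 1 a.
Proof.
move=> bf; rewrite -(tsumA (f := fun x y z => f (antip x * y) z)); last lin.
rewrite -[RHS](tsum_epsl (f := f 1)); last lin.
by apply: eq_tsum => x y; rewrite (tsum_antipl (f := f ^~ y)) //; lin.
Qed.

Lemma antip_cancelr (U : lmodType k) (f : A -> A -> U) a : bilin f ->
  \tsum_(x, y <- cop a) \tsum_(y1, y2 <- cop y) f x (y1 * antip y2) = f a 1.
Proof.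
move=> bf; rewrite -[RHS](tsum_epsr (f := f ^~ 1)); last lin.
by apply: eq_tsum => x y; rewrite (tsum_antipr (f := f x)) //; lin.
Qed.

Lemma tsum_copM (U : lmodType k) (f : A -> A -> U) (a b : A) : bilin f ->
  \tsum_(x, y <- cop (a * b)) f x y
  = \tsum_(a1, a2 <- cop a) \tsum_(b1, b2 <- cop b) f (a1 * b1) (a2 * b2).
Proof.
move=> bf; rewrite copM tsum_comp //; apply: eq_tsum => a1 a2.
rewrite tsum_comp //; apply: eq_tsum => b1 b2; exact: tsum_pure.
Qed.

End Sweedler.

(** * The dual pair and the exchange relations *)

Section Pairing.
Variables (k : fieldType) (H A : hopfAlgType k) (P : qtDualPair H A).
Implicit Types (f g h : H) (a b : A).

Local Notation "⟨ h , a ⟩" := (pair P h a)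
  (at level 0, h at level 99, format "⟨ h ,  a ⟩").

Lemma pair_extr a b : (forall h, ⟨h, a⟩ = ⟨h, b⟩) -> a = b.
Proof.
move=> E; apply/eqP; rewrite -subr_eq0; apply/eqP; apply: (pair_ndr (pairP P)) => h.
by rewrite (linB (f := pair P h : A -> k^o)) ?E ?subrr //; apply: lin_pairr.
Qed.

Lemma pair_extl g h : (forall a, ⟨g, a⟩ = ⟨h, a⟩) -> g = h.
Proof.
move=> E; apply/eqP; rewrite -subr_eq0; apply/eqP; apply: (pair_ndl (pairP P)) => a.
by rewrite (linB (f := (pair P)^~ a : H -> k^o)) ?E ?subrr //; apply: lin_pairl.
Qed.

Lemma pair_tsumr (V W : lmodType k) h (F : V -> W -> A) t :
  ⟨h, tsum F t⟩ = \tsum_(x, y <- t) (⟨h, F x y⟩ : k^o).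
Proof. by apply: (tsum_lin (g := pair P h : A -> k^o)); apply: lin_pairr. Qed.

Lemma pair_tsuml (V W : lmodType k) a (F : V -> W -> H) t :
  ⟨tsum F t, a⟩ = \tsum_(x, y <- t) (⟨F x y, a⟩ : k^o).
Proof. by apply: (tsum_lin (g := (pair P)^~ a : H -> k^o)); apply: lin_pairl. Qed.

Lemma pairZr h c a : ⟨h, c *: a⟩ = c * ⟨h, a⟩.
Proof. by apply: (linZ (f := pair P h : A -> k^o)); apply: lin_pairr. Qed.

Lemma pairZl h c a : ⟨c *: h, a⟩ = c * ⟨h, a⟩.
Proof. by apply: (linZ (f := (pair P)^~ a : H -> k^o)); apply: lin_pairl. Qed.

Lemma pair_hitl g h a : ⟨h, hitl P g a⟩ = ⟨g * h, a⟩.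
Proof.
rewrite (pairM (pairP P)) pair_tsumr; tsum_ext x y; apply: pairZr.
Qed.

Lemma pair_hitr g h a : ⟨h, hitr P g a⟩ = ⟨h * g, a⟩.
Proof.
rewrite (pairM (pairP P)) pair_tsumr; tsum_ext x y.
by rewrite pairZr mulrC.
Qed.

(** This is associativity of [H] read through the pairing; the order is reversed because [hitl]
    transposes a left multiplication. *)
Lemma hitlM g h a : hitl P (g * h) a = hitl P h (hitl P g a).
Proof. by apply: pair_extr => f; rewrite !pair_hitl mulrA. Qed.

Lemma hitlr g h a : hitl P g (hitr P h a) = hitr P h (hitl P g a).
Proof. by apply: pair_extr => f; rewrite pair_hitl !pair_hitr pair_hitl mulrA. Qed.

Lemma hitl1 a : hitl P 1 a = a.
Proof. by apply: pair_extr => f; rewrite pair_hitl mul1r. Qed.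

Lemma eps_hitr g a : eps (hitr P g a) = ⟨g, a⟩.
Proof. by rewrite -(pair1 (pairP P)) pair_hitr mul1r. Qed.

End Pairing.

(** * Translates under the coproduct, and the crossed identity in [H] *)

Section CrossedIdentity.
Variables (k : fieldType) (H A : hopfAlgType k) (P : qtDualPair H A).
Implicit Types (f g h : H) (a b : A).

Local Notation "⟨ h , a ⟩" := (pair P h a)
  (at level 0, h at level 99, format "⟨ h ,  a ⟩").

(** A left translate consumes the outermost left leg, so by coassociativity it only touches the
    first factor of the coproduct. *)
Lemma tsum_hitl (U : lmodType k) (F : A -> A -> U) g a : bilin F ->
  \tsum_(x, y <- cop (hitl P g a)) F x y = \tsum_(x, y <- cop a) F (hitl P g x) y.
Proof.
move=> bF; rewrite /hitl (tsum_lin (g := fun b => tsum F (cop b))); last lin.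
transitivity (\tsum_(x, y <- cop a) \tsum_(y1, y2 <- cop y) (⟨g, x⟩ *: F y1 y2)).
  tsum_ext x y; rewrite -tsumZ; apply: (linZ (f := fun b => tsum F (cop b))); lin.
rewrite -(tsumA (f := fun x y z => ⟨g, x⟩ *: F y z)); last lin.
tsum_ext x y; rewrite (tsum_lin (g := F ^~ y)); last lin.
by tsum_ext x1 x2; rewrite (linZ (f := F ^~ y)) //; lin.
Qed.

Lemma tsum_hitr (U : lmodType k) (F : A -> A -> U) g a : bilin F ->
  \tsum_(x, y <- cop (hitr P g a)) F x y = \tsum_(x, y <- cop a) F x (hitr P g y).
Proof.
move=> bF; rewrite /hitr (tsum_lin (g := fun b => tsum F (cop b))); last lin.
transitivity (\tsum_(x, y <- cop a) \tsum_(x1, x2 <- cop x) (⟨g, y⟩ *: F x1 x2)).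
  tsum_ext x y; rewrite -tsumZ; apply: (linZ (f := fun b => tsum F (cop b))); lin.
rewrite (tsumA (f := fun x y z => ⟨g, z⟩ *: F x y)); last lin.
tsum_ext x y; rewrite (tsum_lin (g := F x)); last lin.
by tsum_ext x1 x2; rewrite (linZ (f := F x)) //; lin.
Qed.

(** Both sides pair [g] with the middle leg of the threefold coproduct, which may be attached to
    either neighbour. *)
Lemma tsum_hitrl (U : lmodType k) (F : A -> A -> U) g a : bilin F ->
  \tsum_(x, y <- cop a) F (hitr P g x) y = \tsum_(x, y <- cop a) F x (hitl P g y).
Proof.
move=> bF.
transitivity (\tsum_(x, y <- cop a) \tsum_(x1, x2 <- cop x) (⟨g, x2⟩ *: F x1 y)).
  tsum_ext x y; rewrite /hitr (tsum_lin (g := F ^~ y)); last lin.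
  by tsum_ext x1 x2; rewrite (linZ (f := F ^~ y)) //; lin.
rewrite (tsumA (f := fun x y z => ⟨g, y⟩ *: F x z)); last lin.
tsum_ext x y; rewrite /hitl (tsum_lin (g := F x)); last lin.
by tsum_ext x1 x2; rewrite (linZ (f := F x)) //; lin.
Qed.

(** The axiom [R2_comm] in terms of translates, with the sum over the coproduct of [a] absorbed. *)
Lemma R2_hit h a :
  \tsum_(x, y <- cop h) (R2 P (hitr P y a) * x) = \tsum_(x, y <- cop h) (y * R2 P (hitl P x a)).
Proof.
have := R2_comm P h a; rewrite exchange_tsum [in RHS]exchange_tsum => E.
transitivity (\tsum_(x, y <- cop h) \tsum_(a1, a2 <- cop a) (⟨y, a2⟩ *: (R2 P a1 * x))).
  tsum_ext x y; rewrite /hitr linear_tsum tsum_mull.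
  by tsum_ext a1 a2; rewrite linearZ /= scalerAl.
rewrite E; tsum_ext x y; rewrite /hitl linear_tsum tsum_mulr.
by tsum_ext a1 a2; rewrite linearZ /= scalerAr.
Qed.

Lemma R1_hit h a :
  \tsum_(x, y <- cop h) (x * R1 P (hitl P y a)) = \tsum_(x, y <- cop h) (R1 P (hitr P x a) * y).
Proof.
have := R1_comm P h a; rewrite exchange_tsum [in RHS]exchange_tsum => E.
transitivity (\tsum_(x, y <- cop h) \tsum_(a1, a2 <- cop a) (⟨y, a1⟩ *: (x * R1 P a2))).
  tsum_ext x y; rewrite /hitl linear_tsum tsum_mulr.
  by tsum_ext a1 a2; rewrite linearZ /= scalerAr.
rewrite E; tsum_ext x y; rewrite /hitr linear_tsum tsum_mull.
by tsum_ext a1 a2; rewrite linearZ /= scalerAl.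
Qed.

(** Insert h_3 S(h_4) on the right of S(h_1) R_1([hitr] h_2 a), apply [R1_hit] to the legs h_2, h_3,
    and cancel the S(h_1) h_2 that appears on the left. *)
Lemma R1_hit_antip h a :
  \tsum_(x, y <- cop h) (antip x * R1 P (hitr P y a))
  = \tsum_(x, y <- cop h) (R1 P (hitl P x a) * antip y).
Proof.
transitivity (\tsum_(x, y <- cop h) \tsum_(u, v <- cop y)
    (antip x * (\tsum_(u1, u2 <- cop u) (R1 P (hitr P u1 a) * u2)) * antip v)).
  tsum_ext x y; rewrite -[LHS]mulr1.
  rewrite -(@antip_cancelr _ _ _ (fun u v => antip x * R1 P (hitr P u a) * v));
    last lin.
  rewrite -(@tsumA _ _ _ (fun u v w => antip x * R1 P (hitr P u a) * (v * antip w)));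
    last lin.
  tsum_ext u v; rewrite tsum_mulr tsum_mull; tsum_ext u1 u2; by rewrite !mulrA.
transitivity (\tsum_(x, y <- cop h) \tsum_(u, v <- cop y)
    (antip x * u * \tsum_(v1, v2 <- cop v) (R1 P (hitl P v1 a) * antip v2))).
  tsum_ext x y.
  transitivity (\tsum_(u, v <- cop y) \tsum_(u1, u2 <- cop u)
    (antip x * u1 * R1 P (hitl P u2 a) * antip v)).
    tsum_ext u v; rewrite -R1_hit tsum_mulr tsum_mull; tsum_ext u1 u2; by rewrite !mulrA.
  rewrite (@tsumA _ _ _ (fun u v w => antip x * u * R1 P (hitl P v a) * antip w));
    last lin.
  tsum_ext u v; rewrite tsum_mulr; tsum_ext v1 v2; by rewrite !mulrA.
rewrite (@antip_cancell _ _ _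
  (fun u v => u * \tsum_(v1, v2 <- cop v) (R1 P (hitl P v1 a) * antip v2))); last lin.
exact: mul1r.
Qed.

(** This solves the exchange relation for [h * R2 P a]: after [R2_hit] the two left translates merge
    into one by S(h_1) h_2, which cancels. *)
Lemma R2_hit_antip h a :
  \tsum_(x, y <- cop h) \tsum_(u, v <- cop y)
    (R2 P (hitr P v (hitl P (antip x) a)) * u) = h * R2 P a.
Proof.
transitivity (\tsum_(x, y <- cop h) \tsum_(u, v <- cop y)
    (v * R2 P (hitl P (antip x * u) a))).
  tsum_ext x y; rewrite R2_hit; tsum_ext u v; by rewrite hitlM.
rewrite (@antip_cancell _ _ _ (fun u v => v * R2 P (hitl P u a))); last lin.
by rewrite hitl1.
Qed.

(** The translate on the right is S(g_1) and g_3 paired with the outer legs of [a]. Once the left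
    side is expanded, the chain is followed backwards from the right side, carrying the legs of [g]
    outwards past R_1 and then past R_2. *)
Lemma adact_qact g h a :
  adact g (qact P h a) = \tsum_(x, y <- cop g) \tsum_(u, v <- cop y)
    qact P (adact u h) (hitr P v (hitl P (antip x) a)).
Proof.
transitivity (\tsum_(a1, a2 <- cop a) \tsum_(x, y <- cop g)
    (x * R2 P a1 * h * R1 P a2 * antip y)).
  rewrite [RHS]exchange_tsum /adact; tsum_ext x y.
  by rewrite /qact tsum_mulr tsum_mull; tsum_ext a1 a2; rewrite !mulrA.
(* The left translate acts on the argument of R_2 alone and the right translate on that of R_1
   alone. *)
transitivity (\tsum_(a1, a2 <- cop a) \tsum_(x, y <- cop g) \tsum_(u, v <- cop y)
    \tsum_(u1, u2 <- cop u) (R2 P (hitl P (antip x) a1) * u1 * h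
       * antip u2 * R1 P (hitr P v a2))); last first.
  rewrite exchange_tsum; tsum_ext x y; rewrite exchange_tsum; tsum_ext u v.
  rewrite /qact tsum_hitr; last lin.
  rewrite tsum_hitl; last lin.
  tsum_ext a1 a2; rewrite tsum_mulr tsum_mull; tsum_ext u1 u2.
  by rewrite !mulrA.
(* [R1_hit_antip] brings the antipode to the far right and turns the right translate inside R_1 into
   a left one. *)
transitivity (\tsum_(a1, a2 <- cop a) \tsum_(x, y <- cop g) \tsum_(u, v <- cop y)
    \tsum_(v1, v2 <- cop v) (R2 P (hitl P (antip x) a1) * u * h
       * R1 P (hitl P v1 a2) * antip v2)); last first.
  tsum_ext a1 a2; tsum_ext x y.
  rewrite (@tsumA _ _ _ (fun u v w => R2 P (hitl P (antip x) a1) * u * h *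
     antip v * R1 P (hitr P w a2))); last lin.
  tsum_ext u v.
  transitivity (R2 P (hitl P (antip x) a1) * u * h *
    \tsum_(v1, v2 <- cop v) (R1 P (hitl P v1 a2) * antip v2)).
    by rewrite tsum_mulr; tsum_ext v1 v2; rewrite !mulrA.
  by rewrite -R1_hit_antip tsum_mulr; tsum_ext v1 v2; rewrite !mulrA.
(* [tsum_hitrl] hands that translate over from the argument of R_1 to that of R_2. *)
transitivity (\tsum_(a1, a2 <- cop a) \tsum_(x, y <- cop g) \tsum_(u, v <- cop y)
    \tsum_(v1, v2 <- cop v) (R2 P (hitr P v1 (hitl P (antip x) a1)) * u * h
       * R1 P a2 * antip v2)); last first.
  rewrite exchange_tsum [in RHS]exchange_tsum; tsum_ext x y.
  rewrite exchange_tsum [in RHS]exchange_tsum; tsum_ext u v.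
  rewrite exchange_tsum [in RHS]exchange_tsum; tsum_ext v1 v2.
  have := @tsum_hitrl _ (fun b c => R2 P (hitl P (antip x) b) * u * h
    * R1 P c * antip v2) v1 a => <-; last lin.
  by tsum_ext a1 a2; rewrite hitlr.
tsum_ext a1 a2.
(* The first three legs of [g] now form the left side of [R2_hit_antip] and contract to one leg in
   front of R_2. *)
transitivity (\tsum_(s, r <- cop g) \tsum_(x, y <- cop s) \tsum_(u, v <- cop y)
   (R2 P (hitr P v (hitl P (antip x) a1)) * u * h * R1 P a2 * antip r)).
  tsum_ext s r; rewrite -[s * _]R2_hit_antip !tsum_mull; tsum_ext x y.
  by rewrite !tsum_mull; tsum_ext u v.
rewrite (@tsumA _ _ _ (fun x y r => \tsum_(u, v <- cop y)
   (R2 P (hitr P v (hitl P (antip x) a1)) * u * h * R1 P a2 * antip r))); last lin.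
tsum_ext x y.
by rewrite (@tsumA _ _ _ (fun u v r =>
   (R2 P (hitr P v (hitl P (antip x) a1)) * u * h * R1 P a2 * antip r))); last lin.
Qed.

End CrossedIdentity.

(** * Antimultiplicativity of the antipode *)

Section Antipode.
Variables (k : fieldType) (A : hopfAlgType k).
Implicit Types a b : A.

Lemma antip1 : antip 1 = 1 :> A.
Proof.
have := antipl (1 : A); rewrite cop1 eps1 scale1r tsum_pure; last lin.
by rewrite mulr1.
Qed.

(** Both sides equal S(a_1 b_1) a_2 b_2 S(b_3) S(a_3): contracting on the right gives S(ab),
    contracting on the left gives S(b) S(a). *)
Lemma antipM a b : antip (a * b) = antip b * antip a.
Proof.
transitivity (\tsum_(x, y <- cop a) \tsum_(y1, y2 <- cop y)
    \tsum_(u, v <- cop b) \tsum_(v1, v2 <- cop v)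
      (antip (x * u) * (y1 * v1) * antip v2 * antip y2)).
  rewrite -[LHS]mulr1.
  rewrite -(@antip_cancelr _ _ _ (fun x w => antip (x * b) * w)); last lin.
  tsum_ext x y; tsum_ext y1 y2.
  rewrite -[y1 in LHS]mulr1.
  rewrite -(@antip_cancelr _ _ _ (fun u w => antip (x * u) * (y1 * w * antip y2)));
    last lin.
  by tsum_ext u v; tsum_ext v1 v2; rewrite !mulrA.
rewrite -(@tsumA _ _ _ (fun x y1 y2 => \tsum_(u, v <- cop b) \tsum_(v1, v2 <- cop v)
      (antip (x * u) * (y1 * v1) * antip v2 * antip y2))); last lin.
rewrite -(@tsum_epsl _ _ _ (fun y => antip b * antip y)); last lin.
tsum_ext x y.
transitivity (\tsum_(u, v <- cop b) \tsum_(x1, x2 <- cop x) \tsum_(u1, u2 <- cop u)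
      (antip (x1 * u1) * (x2 * u2) * antip v * antip y)).
  rewrite [RHS]exchange_tsum; tsum_ext x1 x2.
  by rewrite (@tsumA _ _ _ (fun u v w => antip (x1 * u) * (x2 * v) * antip w * antip y));
    last lin.
rewrite -(@tsum_epsl _ _ _ (fun v => antip v * antip y)); last lin.
rewrite tsumZ; tsum_ext u v.
rewrite -(@tsum_copM _ _ _ (fun p q => antip p * q * antip v * antip y)); last lin.
rewrite (@tsum_antipl _ _ _ (fun w => w * antip v * antip y)); last lin.
by rewrite mul1r epsM scalerA.
Qed.

End Antipode.

(** * Separation of tensors *)

(* Induction on the number of terms: if [ph t0] does not vanish on the last
   component [y0] of the first term, the hypothesis at [t0] expresses its first
   component through the others, and the term is absorbed by replacing each
   other [y] with [y - (ph t0 y / ph t0 y0) y0]. *)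
Lemma tensor_sep (k : fieldType) (V W : lmodType k) (T : Type) (ph : T -> W -> k^o) :
    (forall t, linear (ph t)) ->
    (forall w, (forall t, ph t w = 0) -> w = 0) ->
  forall s s' : V ⊗ W,
    (forall t, \tsum_(x, y <- s) (ph t y *: x) = \tsum_(x, y <- s') (ph t y *: x)) ->
  s = s'.
Proof.
move=> lph sep s s' E; apply/eqP; rewrite -subr_eq0; apply/eqP.
have {}E t : \tsum_(x, y <- (s - s')) (ph t y *: x) = 0.
  rewrite (linB (f := tsum (fun x y => ph t y *: x))) ?E ?subrr //.
  by apply: tsum_linear; split=> [w|v]; [lin | apply: lin_scalel].
move: {s s'}(s - s') E => s E; rewrite [s]tensor_span /tsum.
rewrite /tsum in E; elim: {s}(size _) {-2}(repr s) (leqnn (size (repr s))) E => [|n IHn] r.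
  by case: r => // _ _; rewrite big_nil.
case: r => [|[v0 y0] r] /=; first by rewrite big_nil.
rewrite ltnS => szr E.
have [y00|y0N0] := eqVneq y0 0.
  rewrite big_cons /= y00 -(scale0r (0 : W)) tpureZr scale0r add0r; apply: IHn => // t.
  by have := E t; rewrite big_cons /= y00 (lin0 (f := ph t)) // scale0r add0r.
have /existsNP[t0 /eqP t0N0] : ~ forall t, ph t y0 = 0.
  by move=> /sep y00; rewrite y00 eqxx in y0N0.
have v0E : v0 = - \sum_(p <- r) ((ph t0 p.2 / ph t0 y0) *: p.1).
  have := E t0; rewrite big_cons /= => /(congr1 ( *:%R (ph t0 y0)^-1)).
  rewrite scaler0 scalerDr scalerA mulVf // scale1r => /eqP.
  rewrite addr_eq0 => /eqP ->; rewrite scaler_sumr; congr (- _).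
  by apply: eq_bigr => p _; rewrite scalerA mulrC.
pose r' := [seq (p.1, p.2 - (ph t0 p.2 / ph t0 y0) *: y0) | p <- r].
have r'E (U : lmodType k) (F : V -> W -> U) : bilin F ->
    \sum_(p <- r') F p.1 p.2 = F v0 y0 + \sum_(p <- r) F p.1 p.2.
  move=> bF; rewrite big_map v0E -scaleN1r (linZ (f := F ^~ y0)); last lin.
  rewrite scaleN1r addrC (@lin_sum _ _ _ _ _ _ (F ^~ y0)); last lin.
  rewrite -sumrB; apply: eq_bigr => p _.
  by rewrite (linB (f := F p.1)) ?(linZ (f := F p.1)) ?(linZ (f := F ^~ y0)) //; lin.
rewrite big_cons -r'E /=; last exact: tpure_bilin.
apply: IHn => [|t]; first by rewrite size_map.
rewrite (r'E _ (fun v w => ph t w *: v)); first by have := E t; rewrite big_cons.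
by split=> [w|v]; [lin | apply: lin_scalel].
Qed.

Lemma exchange4_tsum (k : fieldType) (V W V' W' V1 W1 V1' W1' U : lmodType k)
    (s : W -> V1 ⊗ W1) (t : W' -> V1' ⊗ W1')
    (f : V -> V1 -> W1 -> V' -> V1' -> W1' -> U) (a : V ⊗ W) (b : V' ⊗ W') :
  \tsum_(x, y <- a) \tsum_(u, v <- s y) \tsum_(x', y' <- b) \tsum_(u', v' <- t y')
     f x u v x' u' v'
  = \tsum_(x', y' <- b) \tsum_(u', v' <- t y') \tsum_(x, y <- a) \tsum_(u, v <- s y)
     f x u v x' u' v'.
Proof.
transitivity (\tsum_(x, y <- a) \tsum_(x', y' <- b) \tsum_(u, v <- s y)
   \tsum_(u', v' <- t y') f x u v x' u' v').
  by tsum_ext x y; rewrite exchange_tsum.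
rewrite exchange_tsum; tsum_ext x' y'; rewrite [RHS]exchange_tsum; tsum_ext x y.
by rewrite exchange_tsum.
Qed.

(** * The adjoint action *)

Section Adjoint.
Variables (k : fieldType) (H A : hopfAlgType k) (P : qtDualPair H A).
Implicit Types (f g h : H) (a b : A).

Local Notation "⟨ h , a ⟩" := (pair P h a)
  (at level 0, h at level 99, format "⟨ h ,  a ⟩").

Lemma adactM f g h : adact (f * g) h = adact f (adact g h).
Proof.
rewrite /adact (@tsum_copM _ _ _ (fun x y => x * h * antip y)); last lin.
tsum_ext x y; rewrite tsum_mulr tsum_mull; tsum_ext u v.
by rewrite antipM !mulrA.
Qed.

Lemma adact1 h : adact 1 h = h.
Proof.
rewrite /adact cop1 tsum_pure; last lin.
by rewrite mul1r antip1 mulr1.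
Qed.

Lemma adact_unit g : adact g 1 = (eps g)%:A.
Proof. by rewrite /adact -antipr; tsum_ext x y; rewrite mulr1. Qed.

Definition coad h a : A := \tsum_(a1, a2, a3 <- cop3 a) (⟨h, a2⟩ *: (a1 * antip a3)).

(** The coadjoint coaction is the transpose of the adjoint action: the coproduct of [g] splits a_1
    S(a_3), and the three pairings recombine into one with a product in [H]. *)
Lemma pair_coad g h a : ⟨g, coad h a⟩ = ⟨adact g h, a⟩.
Proof.
rewrite /coad cop3E; [|lin|lin]; rewrite pair_tsumr.
transitivity (\tsum_(x, y <- cop g) \tsum_(a1, u <- cop a) \tsum_(a2, a3 <- cop u)
   (⟨x, a1⟩ * (⟨h, a2⟩ * ⟨antip y, a3⟩) : k^o)); last first.
  rewrite /adact pair_tsuml; tsum_ext x y.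
  rewrite -mulrA (pairM (pairP P)); tsum_ext a1 u.
  by rewrite (pairM (pairP P)) [RHS]mulr_sumr.
rewrite exchange_tsum; tsum_ext a1 u; rewrite exchange_tsum pair_tsumr; tsum_ext a2 a3.
rewrite pairZr (pair_cop (pairP P)) [LHS]mulr_sumr; apply: eq_bigr => p _.
by rewrite (pair_antip (pairP P)) mulrCA.
Qed.

(** The conjugation S(a_1) b a_3 occurs in the crossed module axiom, in the coaction of [aug_mul]
    (with b = 1) and, through [pair_conj], in the action of [aug_ad]. Here it is turned into
    translates, to match [adact_qact]. *)
Lemma tsum_pair_conj (U : lmodType k) (F : A -> U) g a b : linear F ->
  \tsum_(a1, a2, a3 <- cop3 a) (⟨g, antip a1 * b * a3⟩ *: F a2)
  = \tsum_(x, y <- cop g) \tsum_(u, v <- cop y)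
      (⟨u, b⟩ *: F (hitr P v (hitl P (antip x) a))).
Proof.
move=> lF; rewrite cop3E; [|lin|lin].
transitivity (\tsum_(x, y <- cop g) \tsum_(u, v <- cop y)
  \tsum_(a1, c <- cop a) \tsum_(a2, a3 <- cop c)
   ((⟨antip x, a1⟩ * (⟨u, b⟩ * ⟨v, a3⟩)) *: F a2)); last first.
  tsum_ext x y; tsum_ext u v.
  rewrite /hitl (@tsum_lin _ _ _ _ _ (fun c => ⟨u, b⟩ *: F (hitr P v c))); last lin.
  tsum_ext a1 c; rewrite (linZ (f := fun d => hitr P v d)); last lin.
  rewrite /hitr (@tsum_lin _ _ _ _ _ (fun d => ⟨u, b⟩ *: F (⟨antip x, a1⟩ *: d)));
    last lin.
  by tsum_ext a2 a3; rewrite !(linZ _ _ lF) !scalerA; congr (_ *: _); rewrite mulrCA.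
rewrite -exchange4_tsum; tsum_ext a1 c; tsum_ext a2 a3.
rewrite -mulrA (pair_cop (pairP P)) [LHS]scaler_suml; apply: eq_bigr => -[x y] _ /=.
rewrite (pair_cop (pairP P)) mulr_sumr scaler_suml; apply: eq_bigr => -[u v] _ /=.
by rewrite (pair_antip (pairP P)).
Qed.

Lemma pair_conj g a b :
  ⟨g, \tsum_(b1, b2 <- cop b) (antip b1 * a * b2)⟩
  = \tsum_(x, y <- cop g) \tsum_(u, v <- cop y)
      (⟨u, a⟩ * eps (hitr P v (hitl P (antip x) b)) : k^o).
Proof.
rewrite -(@tsum_pair_conj _ (fun c => eps c : k^o)); last lin.
rewrite cop3E; [|lin|lin]; rewrite pair_tsumr; tsum_ext b1 c.
(* A counit supplies the missing middle leg: S(b_1) a b_2 is S(b_1) a b_3 weighted by the counit of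
   b_2. *)
rewrite -[LHS](@tsum_epsl _ _ _ (fun d => ⟨g, antip b1 * a * d⟩ : k^o)); last lin.
by tsum_ext u v; exact: mulrC.
Qed.

(** Since Q_1(a) is the action of [a] on 1, this is [adact_qact] at h = 1; the adjoint action on 1
    is a counit, which removes a leg of [g]. *)
Lemma adact_qQ1 g a :
  adact g (qQ1 P a) = \tsum_(x, y <- cop g) qQ1 P (hitr P y (hitl P (antip x) a)).
Proof.
have E b : qQ1 P b = qact P 1 b by rewrite /qQ1 /qact; tsum_ext x y; rewrite mulr1.
rewrite E adact_qact; tsum_ext x y.
rewrite -(@tsum_epsl _ _ _ (fun v => qQ1 P (hitr P v (hitl P (antip x) a)))); last lin.
tsum_ext u v; rewrite adact_unit E; apply: (linZ (f := fun h => qact P h _)); lin.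
Qed.

Lemma pair_qQ1 a b : ⟨qQ1 P a, b⟩ = qQ P a b.
Proof.
rewrite /qQ1 /qQ pair_tsuml; tsum_ext a1 a2; rewrite (pairM (pairP P)).
by tsum_ext b1 b2; rewrite -R1_R2.
Qed.

(** R_1 and R_2 are mutual transposes, so pairing the left side of the hypothesis with [h] and [a]
    gives the pairing of R_2(a_1) h R_1(a_2) with [t]. The summand 1 ⊗ Q_2(t) contributes a multiple
    of [eps h], which is 0. *)
Lemma pair_qact_invariant (t : A) h a :
  \tsum_(t1, t2, t3 <- cop3 t) t2 ⊗ (R1 P t1 * R2 P t3)
    = t ⊗ (1 : H) + (1 : A) ⊗ qQ2 P t ->
  eps h = 0 -> ⟨qact P h a, t⟩ = ⟨h, t⟩ * eps a.
Proof.
move=> /(congr1 (tsum (fun x g => ⟨h, x⟩ * ⟨g, a⟩ : k^o))).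
have bF : bilin (fun x g => ⟨h, x⟩ * ⟨g, a⟩ : k^o) by lin.
have := @tsum_linear _ _ _ _ _ bF 1 (t ⊗ (1 : H)) ((1 : A) ⊗ qQ2 P t).
rewrite !scale1r => ->; rewrite !tsum_pure // (pair1 (pairP P)) (pair_eps (pairP P)).
move=> E h0; rewrite h0 mul0r addr0 in E; rewrite -{}E.
rewrite cop3E; [|lin|lin].
rewrite tsum_comp; last lin.
rewrite /qact pair_tsuml.
transitivity (\tsum_(a1, a2 <- cop a) \tsum_(t1, c <- cop t) \tsum_(t2, t3 <- cop c)
   (⟨R1 P t1, a1⟩ * (⟨h, t2⟩ * ⟨R2 P t3, a2⟩) : k^o)).
  tsum_ext a1 a2; rewrite -mulrA (pairM (pairP P)); tsum_ext t1 c.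
  rewrite (pairM (pairP P)) [LHS]mulr_sumr; apply: eq_bigr => p _.
  by rewrite -!R1_R2.
rewrite exchange_tsum; tsum_ext t1 c.
rewrite exchange_tsum tsum_comp; last lin; tsum_ext t2 t3.
rewrite tsum_pure; last lin.
by rewrite (pairM (pairP P)) [RHS]mulr_sumr; apply: eq_bigr => p _; rewrite mulrCA.
Qed.

End Adjoint.

(** * Ideals and the coadjoint coaction on [H^+] *)

Lemma ideal_tsum (k : fieldType) (H : algType k) (I : two_sided_ideal H) (V W : lmodType k)
    (F : V -> W -> H) t : (forall x y, F x y \in I) -> tsum F t \in I.
Proof.
move=> FI; have [I0 IZ] := ideal_submod I; rewrite /tsum; elim/big_ind: _ => //.
by move=> x y Ix Iy; rewrite -[x]scale1r IZ.
Qed.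

Section Quotient.
Variables (k : fieldType) (H A : hopfAlgType k) (P : qtDualPair H A).
Variable I : two_sided_ideal H.
Implicit Types (f g : H) (a b : A) (h : aug H).

Local Notation "⟨ h , a ⟩" := (pair P h a)
  (at level 0, h at level 99, format "⟨ h ,  a ⟩").
Local Notation pi := (aug_pi I).

Lemma aug_pi_surj (x : aug_quot I) : exists h, x = pi h.
Proof. by exists (repr x); rewrite aug_pi_repr. Qed.

Lemma repr_aug_pi h : (repr (pi h) : H) - (h : H) \in I.
Proof. by apply/aug_pi_eq; rewrite aug_pi_repr. Qed.

Lemma eps_adact_aug g h : eps (adact g h) = 0.
Proof. exact: (eps_aug (adact_aug g h)). Qed.

(** Regularity gives a tensor in [H ⊗ A], whose first leg may be projected to [H^+]: its counit
    contraction is the coadjoint map at 1, which pairs with every [g] to the counit of g . h, hence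
    to 0. *)
Lemma regular_aug : regular_pair P -> forall h, exists t : aug H ⊗ A,
  right_coadjoint P h (\tsum_(x, y <- t) aug_val x ⊗ y).
Proof.
move=> reg h; have [t tP] := reg h.
exists (\tsum_(x, y <- t) proj_aug x ⊗ y) => a.
have t0 : \tsum_(x, y <- t) (eps x *: y) = 0.
  have -> : \tsum_(x, y <- t) (eps x *: y) = coad P h 1.
    by rewrite -[RHS](tP 1); tsum_ext x y; rewrite (pair_eps (pairP P)).
  apply: (pair_ndr (pairP P)) => g.
  by rewrite pair_coad (pair_eps (pairP P)) eps_adact_aug.
rewrite -[RHS]tP -[RHS]subr0 -(scaler0 _ (eps a)) -t0 tsumZ -tsumB.
rewrite tsum_comp; last lin.
rewrite tsum_comp; last lin.
tsum_ext x y.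
rewrite tsum_pure; last lin.
rewrite tsum_pure; last lin.
rewrite /= (linB (f := fun z => ⟨z, a⟩ : k^o)); last lin.
by rewrite pairZl (pair1 (pairP P)) scalerBl scalerA [eps a * _]mulrC.
Qed.

Lemma right_coadjoint_adact h (t : aug H ⊗ A) g :
  right_coadjoint P h (\tsum_(x, y <- t) aug_val x ⊗ y) ->
  \tsum_(x, y <- t) (⟨g, y⟩ *: x) = adact_aug g h.
Proof.
move=> tP; apply: val_inj; apply: (@pair_extl _ _ _ P) => a /=.
rewrite -pair_coad /coad -(tP a).
rewrite tsum_comp; last lin.
rewrite pair_tsumr (tsum_lin (g := @aug_val k H)); last exact: aug_val_linear.
rewrite pair_tsuml; tsum_ext x y.
rewrite tsum_pure; last lin.
by rewrite pairZr (linZ (f := @aug_val k H)) ?pairZl 1?mulrC //; exact: aug_val_linear.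
Qed.

End Quotient.

(** * The crossed module *)

Section Evaluation.
Variables (k : fieldType) (H A : hopfAlgType k) (P : qtDualPair H A).
Variable V : lmodType k.

Local Notation "⟨ h , a ⟩" := (pair P h a)
  (at level 0, h at level 99, format "⟨ h ,  a ⟩").

Lemma teval_linear g : linear (@teval _ _ _ P V g).
Proof. by apply: tsum_linear; lin. Qed.

Lemma teval_pure g (v : V) a : teval P g (v ⊗ a) = ⟨g, a⟩ *: v.
Proof. by rewrite /teval tsum_pure //; lin. Qed.

Lemma teval_tsum (X Y : lmodType k) g (F : X -> Y -> V ⊗ A) t :
  teval P g (tsum F t) = \tsum_(x, y <- t) teval P g (F x y).
Proof. by apply: (tsum_lin (g := teval P g)); apply: teval_linear. Qed.

Lemma teval_sep (s t : V ⊗ A) : (forall g, teval P g s = teval P g t) -> s = t.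
Proof.
apply: (tensor_sep (ph := fun g a => ⟨g, a⟩ : k^o)) => [g|a]; first by lin.
exact: (pair_ndr (pairP P)).
Qed.

(** Meant for coassociativity. That pairs (f, g) separate [A ⊗ A] is itself an instance of
    [tensor_sep]: contract the second leg with [g], then pair with [f]. *)
Lemma teval2_sep (s t : V ⊗ (A ⊗ A)) :
  (forall f g, \tsum_(v, u <- s) ((\tsum_(x, y <- u) (⟨f, x⟩ * ⟨g, y⟩ : k^o)) *: v)
     = \tsum_(v, u <- t) ((\tsum_(x, y <- u) (⟨f, x⟩ * ⟨g, y⟩ : k^o)) *: v)) -> s = t.
Proof.
move=> E; apply: (tensor_sep (T := H * H)
  (ph := fun p u => \tsum_(x, y <- u) (⟨p.1, x⟩ * ⟨p.2, y⟩ : k^o))) => [[f g]|u uP|[f g]].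
- by lin.
- apply: (tensor_sep (ph := fun g a => ⟨g, a⟩ : k^o)) => [g|a|g]; first by lin.
    exact: (pair_ndr (pairP P)).
  rewrite [RHS](lin0 (f := fun s => \tsum_(x, y <- s) (⟨g, y⟩ *: x))); last by lin.
  apply: (pair_ndr (pairP P)) => f; rewrite pair_tsumr -[RHS](uP (f, g)).
  by tsum_ext x y; rewrite pairZr mulrC.
- exact: E.
Qed.

End Evaluation.

Section Quotient.
Variables (k : fieldType) (H A : hopfAlgType k) (P : qtDualPair H A).
Variable I : two_sided_ideal H.
Variable D : aug H -> aug H ⊗ A.
Hypothesis DP : forall h : aug H, right_coadjoint P h (\tsum_(x, y <- D h) aug_val x ⊗ y).
Implicit Types (f g : H) (a b : A) (h : aug H).

Local Notation "⟨ h , a ⟩" := (pair P h a)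
  (at level 0, h at level 99, format "⟨ h ,  a ⟩").
Local Notation pi := (aug_pi I).

(** Both maps use chosen representatives, and [D] is not assumed linear. Independence of the choices
    follows in [quot_actE] and, through evaluation at elements of [H], in [quot_coactE]. *)
Definition quot_crossed : crossedData A (aug_quot I) := {|
  act := fun (x : aug_quot I) a => pi (qact_aug P (repr x) a);
  coact := fun x : aug_quot I => \tsum_(u, y <- D (repr x)) pi u ⊗ y |}.
Local Notation X := quot_crossed.

Lemma quot_actE h a : act X (pi h) a = pi (qact_aug P h a).
Proof.
apply/aug_pi_eq => /=.
rewrite -(linB (f := fun h => qact P h a)); last lin.
apply: ideal_tsum => x y;  apply: Defs.idealMr; apply: idealMl; exact: repr_aug_pi.
Qed.

Lemma quot_coactE g h : teval P g (coact X (pi h)) = pi (adact_aug g h).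
Proof.
rewrite /= teval_tsum.
transitivity (pi (adact_aug g (repr (pi h)))).
  rewrite -(right_coadjoint_adact _ (DP _)) (tsum_lin (g := aug_pi I)); last exact: aug_pi_linear.
  by tsum_ext x y; rewrite teval_pure (linZ (f := aug_pi I)) //; exact: aug_pi_linear.
apply/aug_pi_eq => /=.
rewrite -(linB (f := fun h => adact g h)); last lin.
apply: ideal_tsum => x y; apply: Defs.idealMr; apply: idealMl; exact: repr_aug_pi.
Qed.

(** Evaluated at each [g] the coaction is the adjoint action of [g], which is linear; evaluations
    separate tensors. *)
Lemma quot_coact_linear : linear (coact X).
Proof.
move=> c x y; apply: (@teval_sep _ _ _ P) => g; rewrite teval_linear.
have [[h ->] [h' ->]] := (aug_pi_surj x, aug_pi_surj y).
rewrite -aug_pi_linear !quot_coactE -aug_pi_linear; congr (pi _).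
have L : linear (fun h => adact_aug g h) by lin.
exact: L.
Qed.

Lemma quot_induced : induced_crossed P X.
Proof.
split=> [h a|h]; first exact: quot_actE.
exists (D h); split; first exact: DP.
apply: (@teval_sep _ _ _ P) => g; rewrite quot_coactE teval_tsum.
rewrite -(right_coadjoint_adact _ (DP _)) (tsum_lin (g := aug_pi I)); last exact: aug_pi_linear.
by tsum_ext x y; rewrite teval_pure (linZ (f := aug_pi I)) //; exact: aug_pi_linear.
Qed.

Lemma quot_act_bilin : bilin (act X).
Proof.
split=> [a c x y|x c a b].
  have [[h ->] [h' ->]] := (aug_pi_surj x, aug_pi_surj y).
  rewrite -aug_pi_linear !quot_actE -aug_pi_linear; congr (pi _).
  have L : linear (fun h => qact_aug P h a) by lin.
  exact: L.
have [h ->] := aug_pi_surj x.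
rewrite !quot_actE -aug_pi_linear; congr (pi _).
have L : linear (fun a => qact_aug P h a) by lin.
exact: L.
Qed.

Lemma qact1 f : qact P f 1 = f.
Proof.
rewrite /qact cop1 tsum_pure; last lin.
by rewrite R1_1 R2_1 mul1r mulr1.
Qed.

Lemma qactM f a b : qact P f (a * b) = qact P (qact P f a) b.
Proof.
rewrite /qact (@tsum_copM _ _ _ (fun x y => R2 P x * f * R1 P y)); last lin.
rewrite exchange_tsum; tsum_ext b1 b2; rewrite tsum_mulr tsum_mull; tsum_ext a1 a2.
by rewrite R1_M R2_M !mulrA.
Qed.

Lemma quot_crossed_module : crossed_module X.
Proof.
have Lc := quot_coact_linear; have Ba := quot_act_bilin.
split=> //.
- move=> v; have [h ->] := aug_pi_surj v; rewrite quot_actE; congr (pi _).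
  by apply: val_inj; rewrite /= qact1.
- move=> v a b; have [h ->] := aug_pi_surj v; rewrite !quot_actE; congr (pi _).
  by apply: val_inj; rewrite /= qactM.
- move=> v; have [h ->] := aug_pi_surj v.
  (* The counit of [A] is pairing with 1, so the axiom says that 1 acts trivially. *)
  transitivity (teval P 1 (coact X (pi h))).
    by rewrite /teval; tsum_ext x y; rewrite (pair1 (pairP P)).
  by rewrite quot_coactE; congr (pi _); apply: val_inj; rewrite /= adact1.
- move=> v; apply: (@teval2_sep _ _ _ P) => f g.
  rewrite tsum_comp; last lin.
  rewrite tsum_comp; last lin.
  have [h ->] := aug_pi_surj v.
  (* Tested against [f] and [g], coassociativity is the associativity of the adjoint action. *)
  transitivity (teval P f (coact X (teval P g (coact X (pi h))))).
    rewrite {2}/teval (@tsum_lin _ _ _ _ _ (fun x => teval P f (coact X x))); last lin.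
    tsum_ext x y; rewrite (linZ (f := fun x => teval P f (coact X x))); last lin.
    rewrite tsum_comp; last lin.
    rewrite tsumZ; tsum_ext u z.
    rewrite tsum_pure; last lin.
    rewrite tsum_pure; last lin.
    by rewrite scalerA mulrC.
  transitivity (teval P (f * g) (coact X (pi h))).
    by rewrite !quot_coactE; congr (pi _); apply: val_inj; rewrite /= adactM.
  rewrite /teval; tsum_ext x y; rewrite tsum_pure; last lin.
  by rewrite (pairM (pairP P)).
- move=> v a; apply: (@teval_sep _ _ _ P) => g.
  have [h ->] := aug_pi_surj v.
  rewrite quot_actE quot_coactE teval_tsum.
  (* The right side of the compatibility axiom, evaluated at [g] by [tsum_pair_conj], takes the
     shape of [adact_qact]. *)
  transitivity (\tsum_(v0, v1 <- coact X (pi h)) \tsum_(x, y <- cop g) \tsum_(u, v <- cop y)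
     (⟨u, v1⟩ *: act X v0 (hitr P v (hitl P (antip x) a)))); last first.
    tsum_ext v0 v1; rewrite -tsum_pair_conj; last lin.
    rewrite teval_tsum; tsum_ext a1 c; rewrite teval_tsum; tsum_ext a2 a3.
    by rewrite teval_pure.
  rewrite exchange_tsum.
  transitivity (\tsum_(x, y <- cop g) \tsum_(u, v <- cop y)
     pi (qact_aug P (adact_aug u h) (hitr P v (hitl P (antip x) a)))); last first.
    tsum_ext x y; rewrite exchange_tsum; tsum_ext u w.
    rewrite -quot_actE -quot_coactE /teval.
    rewrite (@tsum_lin _ _ _ _ _ (fun z => act X z (hitr P w (hitl P (antip x) a))));
      last lin.
    by tsum_ext v0 v1; rewrite (linZ (f := fun z => act X z _)) //; lin.
  transitivity (pi (\tsum_(x, y <- cop g) \tsum_(u, v <- cop y)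
     qact_aug P (adact_aug u h) (hitr P v (hitl P (antip x) a)))).
    congr (pi _); apply: val_inj => /=; rewrite adact_qact.
    rewrite (@tsum_lin _ _ _ _ _ (@aug_val k H)); last exact: aug_val_linear.
    tsum_ext x y.
    by rewrite (@tsum_lin _ _ _ _ _ (@aug_val k H)); last exact: aug_val_linear.
  rewrite (@tsum_lin _ _ _ _ _ (aug_pi I)); last exact: aug_pi_linear.
  tsum_ext x y.
  by rewrite (@tsum_lin _ _ _ _ _ (aug_pi I)); last exact: aug_pi_linear.
Qed.

End Quotient.

(** * The calculus and its augmentation *)

Section Calculus.
Variables (k : fieldType) (H A : hopfAlgType k) (P : qtDualPair H A).
Variable I : two_sided_ideal H.
Variable D : aug H -> aug H ⊗ A.
Hypothesis DP : forall h : aug H, right_coadjoint P h (\tsum_(x, y <- D h) aug_val x ⊗ y).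
Implicit Types (f g : H) (a b : A) (h : aug H).

Local Notation "⟨ h , a ⟩" := (pair P h a)
  (at level 0, h at level 99, format "⟨ h ,  a ⟩").
Local Notation pi := (aug_pi I).
Local Notation X := (quot_crossed P I D).
Local Notation w := (fun a : aug A => pi (qQ1_aug P a)).

Lemma qQ11 : qQ1 P 1 = 1.
Proof.
rewrite /qQ1 cop1 tsum_pure; last lin.
by rewrite R1_1 R2_1 mul1r.
Qed.

Lemma qQ1_proj a : qQ1 P (proj_aug a) = qQ1 P a - (eps a)%:A.
Proof.
rewrite /= (linB (f := fun a => qQ1 P a)); last lin.
by rewrite (linZ (f := fun a => qQ1 P a)) ?qQ11 //; lin.
Qed.

Lemma qQ1M a b : qQ1 P (a * b) = qact P (qQ1 P a) b.
Proof.
have E c : qQ1 P c = qact P 1 c by rewrite /qQ1 /qact; tsum_ext x y; rewrite mulr1.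
by rewrite !E qactM.
Qed.

Lemma tsum_eps_conj g a :
  \tsum_(x, y <- cop g) (eps (hitr P y (hitl P (antip x) a)) : k^o) = eps g * eps a.
Proof.
transitivity (\tsum_(x, y <- cop g) (⟨antip x * y, a⟩ : k^o)).
  by tsum_ext x y; rewrite eps_hitr pair_hitl.
rewrite (@tsum_antipl _ _ _ (fun z => ⟨z, a⟩ : k^o)); last lin.
by rewrite (pair1 (pairP P)).
Qed.

Lemma quot_calculus : gen_calculus X w.
Proof.
have MX := quot_crossed_module I DP.
split=> //; split=> [|v a|v].
- lin.
- rewrite quot_actE; congr (pi _); apply: val_inj => /=; exact: qQ1M.
apply: (@teval_sep _ _ _ P) => g.
have Lw : linear w by lin.
rewrite (quot_coactE I DP) -[coact (aug_mul A) v]/(\tsum_(a1, a2, a3 <- cop3 (v : A))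
  proj_aug a2 ⊗ (antip a1 * a3)) tsum_comp; last lin.
(* The inserted 1 plays the part of [b] in [tsum_pair_conj]; its coefficient is then a counit on
   [u]. *)
transitivity (\tsum_(a1, a2, a3 <- cop3 (v : A)) (⟨g, antip a1 * 1 * a3⟩ *: w (proj_aug a2))); last first.
  rewrite teval_tsum; tsum_ext a1 c.
  rewrite tsum_comp; last lin.
  rewrite teval_tsum; tsum_ext a2 a3.
  rewrite tsum_pure; last lin.
  by rewrite teval_pure mulr1.
rewrite (@tsum_pair_conj _ _ _ _ _ (fun b => w (proj_aug b))); last lin.
transitivity (\tsum_(x, y <- cop g) w (proj_aug (hitr P y (hitl P (antip x) v)))); last first.
  tsum_ext x y.
  rewrite -(@tsum_epsl _ _ _ (fun z => w (proj_aug (hitr P z (hitl P (antip x) v)))));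
    last lin.
  by tsum_ext u z; rewrite (pair_eps (pairP P)).
rewrite -(@tsum_lin _ _ _ _ _ (aug_pi I)); last exact: aug_pi_linear.
congr (pi _); apply: val_inj.
rewrite [RHS](@tsum_lin _ _ _ _ _ (@aug_val k H)); last exact: aug_val_linear.
(* Projecting to [A^+] subtracts counits, whose total is [eps g * eps v], that is 0. *)
transitivity (\tsum_(x, y <- cop g) (qQ1 P (hitr P y (hitl P (antip x) v))
   - (eps (hitr P y (hitl P (antip x) v)))%:A)); last first.
  by tsum_ext x y; rewrite -qQ1_proj.
rewrite tsumB -adact_qQ1.
rewrite -(@tsum_lin _ _ _ k^o _ (fun c => c%:A)); last by lin.
by rewrite tsum_eps_conj eps_aug mulr0 scale0r subr0.
Qed.

(** Centrality makes the action of [b] on [th] equal to [th * qQ1 P b]. For the one-form 1 ⊗ [th],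
    the differential and the commutator then differ in their second leg by -(th - 1) Q_1(π b), which
    lies in [I]. *)
Lemma quot_inner :
  (exists th : H,
     [/\ th \in aug_pred H, th \notin I,
         forall h : H, th * h = h * th &
         forall h : H, h \in aug_pred H -> (th - 1) * h \in I]) ->
  inner_calculus X w.
Proof.
case=> th [th0 _ thC thI].
have Ba := quot_act_bilin P I D.
exists (1 ⊗ pi (Aug th0)) => a.
rewrite /om_rmul /om_lmul /om_d.
rewrite tsum_pure; last lin.
rewrite tsum_pure; last lin.
rewrite mulr1 -[a in X in _ - X](cop_epsr a).
rewrite (@tsum_lin _ _ _ _ _ (fun c => c ⊗ pi (Aug th0))); last lin.
rewrite -tsumB; tsum_ext b1 b2.
rewrite mul1r tpureZl -tpureZr.
rewrite -[RHS](linB (f := fun z => b1 ⊗ z)); last lin.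
congr (_ ⊗ _); rewrite quot_actE -(linZ (f := aug_pi I)); last exact: aug_pi_linear.
rewrite -(linB (f := aug_pi I)); last exact: aug_pi_linear.
apply/aug_pi_eq.
rewrite (linB (f := @aug_val k H)); last exact: aug_val_linear.
rewrite (linZ (f := @aug_val k H)) /=; last exact: aug_val_linear.
have -> : qact P th b2 = th * qQ1 P b2.
  by rewrite /qact /qQ1 tsum_mulr; tsum_ext x y; rewrite mulrA thC.
have -> : qQ1 P (b2 - (eps b2)%:A) - (th * qQ1 P b2 - eps b2 *: th)
    = (-1) *: ((th - 1) * qQ1 P (proj_aug b2)).
  rewrite scaleN1r -[qQ1 P (b2 - _)]/(qQ1 P (proj_aug b2)) mulrBl mul1r [RHS]opprB.
  by congr (_ - _); rewrite qQ1_proj mulrBr mulr_algr.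
have [I0 IZ] := ideal_submod I.
rewrite -[_ *: _]addr0; apply: IZ => //; apply: thI.
by rewrite inE eps_qQ1 eps_aug.
Qed.

(** * The augmentation and its Lie derivative *)

Section Augmented.
Variable ts : A.
Hypothesis tsI : perp P I ts.
Hypothesis tsE : \tsum_(t1, t2, t3 <- cop3 ts) t2 ⊗ (R1 P t1 * R2 P t3)
  = ts ⊗ (1 : H) + (1 : A) ⊗ qQ2 P ts.

Lemma pair_aug_map g h :
  ⟨g, coad P h ts - ⟨h, ts⟩%:A⟩ = ⟨adact g h, ts⟩ - eps g * ⟨h, ts⟩.
Proof.
rewrite (linB (f := fun a => ⟨g, a⟩ : k^o)); last lin.
by rewrite pair_coad pairZr (pair_eps (pairP P)) mulrC.
Qed.

Fact aug_map_subproof h : coad P h ts - ⟨h, ts⟩%:A \in aug_pred A.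
Proof. by rewrite inE -(pair1 (pairP P)) pair_aug_map adact1 eps1 mul1r subrr. Qed.
Definition aug_map h : aug A := Aug (aug_map_subproof h).

Definition quot_aug_map (x : aug_quot I) : aug A := aug_map (repr x).

(** Changing [h] by an element of [I] changes g . h by an element of [I] as well, and [ts] vanishes
    on [I]. *)
Lemma quot_aug_mapE h : quot_aug_map (pi h) = aug_map h.
Proof.
apply: val_inj; apply: (@pair_extr _ _ _ P) => g; rewrite /= !pair_aug_map.
have [_ tI] := tsI.
have E f f' : f - f' \in I -> ⟨f, ts⟩ = ⟨f', ts⟩.
  move=> /tI; rewrite (linB (f := fun f => ⟨f, ts⟩ : k^o)); last lin.
  by move/eqP; rewrite subr_eq0 => /eqP.
have Ir := repr_aug_pi I h; congr (_ - _ * _); apply: E => //.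
rewrite -(linB (f := fun f => adact g f)); last lin.
by apply: ideal_tsum => x y; apply: Defs.idealMr; apply: idealMl.
Qed.

Lemma pair_quot_aug_map g h :
  ⟨g, quot_aug_map (pi h)⟩ = ⟨adact g h, ts⟩ - eps g * ⟨h, ts⟩.
Proof. by rewrite quot_aug_mapE /= pair_aug_map. Qed.

Lemma quot_augmented : augmented_by X quot_aug_map.
Proof.
have Li : linear quot_aug_map.
  move=> c x y; apply: val_inj; apply: (@pair_extr _ _ _ P) => g.
  have [[h ->] [h' ->]] := (aug_pi_surj x, aug_pi_surj y).
  rewrite -aug_pi_linear.
  have L : linear (fun h => ⟨g, quot_aug_map (pi h)⟩ : k^o).
    move=> d u v; rewrite !pair_quot_aug_map.
    have L : linear (fun h : aug H => ⟨adact g h, ts⟩ - eps g * ⟨h, ts⟩ : k^o) by lin.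
    exact: L.
  have Lp : linear (fun z : aug A => ⟨g, aug_val z⟩ : k^o) by lin.
  exact: etrans (L c h h') (esym (Lp c _ _)).
split=> // [v a|v].
- have [h ->] := aug_pi_surj v.
  apply: val_inj; apply: (@pair_extr _ _ _ P) => g.
  (* Compatibility with the action, tested against [g]. The two terms of the augmentation are
     compared separately: the first by [adact_qact] and the invariance of [ts], the second by
     [tsum_eps_conj]. *)
  rewrite quot_actE [LHS]pair_quot_aug_map [RHS]/= pair_conj /= adact_qact.
  rewrite (pair_qact_invariant _ tsE) ?eps_aug //.
  transitivity (\tsum_(x, y <- cop g) \tsum_(u, v <- cop y)
     ((⟨adact u h, ts⟩ * eps (hitr P v (hitl P (antip x) a)) : k^o)
      - ((eps u * ⟨h, ts⟩) * eps (hitr P v (hitl P (antip x) a)) : k^o))); last first.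
    by tsum_ext x y; tsum_ext u z; rewrite pair_quot_aug_map mulrBl.
  rewrite -[RHS](@eq_tsum _ _ _ k^o
    (fun x y => \tsum_(u, v <- cop y) (⟨adact u h, ts⟩ * eps (hitr P v (hitl P (antip x) a)) : k^o)
      - ⟨h, ts⟩ * eps (hitr P y (hitl P (antip x) a)) : k^o)); last first.
    move=> x y; rewrite tsumB; congr (_ - _).
    rewrite -(@tsum_epsl _ _ k^o (fun z => ⟨h, ts⟩ * eps (hitr P z (hitl P (antip x) a)) : k^o));
      last lin.
    by tsum_ext u z; exact: mulrA.
  rewrite tsumB; congr (_ - _).
    rewrite pair_tsuml; tsum_ext x y; rewrite pair_tsuml; tsum_ext u z.
    by rewrite (pair_qact_invariant _ tsE) ?eps_adact_aug.
  rewrite -(@tsum_lin _ _ _ k^o k^o (fun z => ⟨h, ts⟩ * z)); last lin.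
  by rewrite tsum_eps_conj; ring.
- have [h ->] := aug_pi_surj v.
  apply: (@teval_sep _ _ _ P) => g; rewrite !teval_tsum.
  (* Compatibility with the coaction, evaluated at [g] and then paired with [f]: both sides become
     (fg) . h paired with [ts], minus [eps f] times g . h paired with [ts]. *)
  transitivity (quot_aug_map (teval P g (coact X (pi h)))); last first.
    rewrite {1}/teval (tsum_lin (g := quot_aug_map)) //; tsum_ext x y.
    by rewrite teval_pure (linZ (f := quot_aug_map)).
  rewrite (quot_coactE I DP); apply: val_inj; apply: (@pair_extr _ _ _ P) => f.
  rewrite [RHS]pair_quot_aug_map /= -adactM.
  rewrite (@tsum_lin _ _ _ _ _ (@aug_val k A)); last exact: aug_val_linear.
  set c := aug_val (quot_aug_map (pi h)).
  (* This is Δc - 1 ⊗ c with [g] paired into the second leg. *)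
  transitivity ⟨f, hitr P g c - ⟨g, c⟩%:A⟩.
    congr (pair P f _).
    have -> : ⟨g, c⟩ = \tsum_(x, y <- cop c) (eps x * ⟨g, y⟩ : k^o).
      by rewrite -(@tsum_epsl _ _ k^o (fun z => ⟨g, z⟩ : k^o)) //; lin.
    rewrite (@tsum_lin _ _ _ k^o _ (fun z => z%:A)); last lin.
    rewrite /hitr -tsumB; tsum_ext x y.
    rewrite teval_pure (linZ (f := @aug_val k A)) /=; last exact: aug_val_linear.
    by rewrite scalerBr scalerA mulrC.
  rewrite (linB (f := fun a => ⟨f, a⟩ : k^o)); last lin.
  rewrite pair_hitr pairZr (pair_eps (pairP P)) !pair_quot_aug_map epsM.
  by ring.
Qed.

Lemma quot_lie_derivative a :
  lie_derivative w quot_aug_map a =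
    \tsum_(a1, a2 <- cop a) (qQ P a1 ts *: a2) - \tsum_(a1, a2 <- cop a) (qQ P a2 ts *: a1).
Proof.
have [Li _ _] := quot_augmented.
have Lw : linear w by lin.
rewrite /lie_derivative /om_i /om_d tsum_comp; last lin.
apply: (@pair_extr _ _ _ P) => g.
have et : eps ts = 0 by have [/eqP] := tsI.
(* The projection to [A^+] subtracts a multiple of 1, which contributes nothing since [eps ts] is
   0. *)
have iE y b : ⟨y, quot_aug_map (w (proj_aug b))⟩ = ⟨adact y (qQ1 P b), ts⟩ - eps y * qQ P b ts.
  rewrite pair_quot_aug_map -[aug_val (qQ1_aug _ _)]/(qQ1 P (proj_aug b)) qQ1_proj.
  rewrite (linB (f := fun z => adact y z)); last lin.
  rewrite !(linB (f := fun z => ⟨z, ts⟩ : k^o)); [|lin|lin].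
  rewrite (linZ (f := fun z => adact y z)); last lin.
  by rewrite adact_unit !pairZl (pair1 (pairP P)) et pair_qQ1; ring.
transitivity (\tsum_(a1, a2 <- cop a) \tsum_(x, y <- cop g)
   ((⟨x, a1⟩ * ⟨adact y (qQ1 P a2), ts⟩ : k^o) - (⟨x, a1⟩ * (eps y * qQ P a2 ts) : k^o))).
  rewrite pair_tsumr; tsum_ext a1 a2.
  rewrite tsum_pure; last lin.
  rewrite (pair_cop (pairP P)); tsum_ext x y.
  by rewrite iE mulrBr.
have qQE b : qQ P b ts = ⟨qQ1 P b, ts⟩ by rewrite pair_qQ1.
rewrite (linB (f := fun b => ⟨g, b⟩ : k^o)); last lin.
rewrite -[LHS](@eq_tsum _ _ _ k^o (fun a1 a2 =>
   \tsum_(x, y <- cop g) (⟨x, a1⟩ * ⟨adact y (qQ1 P a2), ts⟩ : k^o) -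
   \tsum_(x, y <- cop g) (⟨x, a1⟩ * (eps y * qQ P a2 ts) : k^o) : k^o)); last first.
  by move=> a1 a2; rewrite tsumB.
rewrite tsumB; congr (_ - _).
  (* The first term: covariance of Q_1 makes the left translate one by g_1 S(g_2), which cancels and
     leaves the right translate by [g]. *)
  transitivity (⟨qQ1 P (hitr P g a), ts⟩); last first.
    rewrite /hitr (@tsum_lin _ _ _ _ _ (fun b => qQ1 P b)); last lin.
    rewrite pair_tsuml pair_tsumr; tsum_ext a1 a2.
    by rewrite (linZ (f := fun b => qQ1 P b)) ?pairZl ?pairZr ?qQE 1?mulrC //; lin.
  rewrite exchange_tsum.
  transitivity (\tsum_(x, y <- cop g) \tsum_(u, v <- cop y)
     (⟨qQ1 P (hitr P v (hitl P (x * antip u) a)), ts⟩ : k^o)); last first.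
    rewrite -(@tsumA _ _ _ (fun x u v => ⟨qQ1 P (hitr P v (hitl P (x * antip u) a)), ts⟩ : k^o));
      last lin.
    rewrite -[RHS](@tsum_epsl _ _ k^o (fun z => ⟨qQ1 P (hitr P z a), ts⟩ : k^o));
      last lin.
    tsum_ext x y.
    rewrite (@tsum_antipr _ _ _ (fun z => ⟨qQ1 P (hitr P y (hitl P z a)), ts⟩ : k^o));
      last lin.
    by rewrite hitl1.
  tsum_ext x y.
  transitivity (⟨adact y (qQ1 P (hitl P x a)), ts⟩).
    rewrite /hitl (@tsum_lin _ _ _ _ k^o (fun b => ⟨adact y (qQ1 P b), ts⟩ : k^o));
      last lin.
    tsum_ext a1 a2.
    by rewrite (linZ (f := fun b => ⟨adact y (qQ1 P b), ts⟩ : k^o)) //; lin.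
  rewrite adact_qQ1 pair_tsuml; tsum_ext u v; by rewrite hitlM.
(* In the second term the counit of [y] collapses the coproduct of [g]. *)
rewrite pair_tsumr; tsum_ext a1 a2; rewrite pairZr.
rewrite -(@tsum_epsr _ _ k^o (fun z => qQ P a2 ts * ⟨z, a1⟩ : k^o)); last lin.
by tsum_ext x y; rewrite -[_ *: _]/(_ * _); ring.
Qed.

End Augmented.
End Calculus.

Theorem corollary5p4 (k : fieldType) (char_k : 2%N \notin [pchar k])
    (H A : hopfAlgType k) (P : qtDualPair H A) (regP : regular_pair P)
    (I : two_sided_ideal H) (subI : {subset I <= aug_pred H}) :
  exists X : crossedData A (aug_quot I),
  let w : aug A -> aug_quot I := fun a => aug_pi I (qQ1_aug P a) in
  [/\ induced_crossed P X,
      crossed_module X,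
      gen_calculus X w,
      (exists th : H,
         [/\ th \in aug_pred H, th \notin I,
             forall h : H, th * h = h * th &
             forall h : H, h \in aug_pred H -> (th - 1) * h \in I]) ->
      inner_calculus X w &
      forall ts : A, perp P I ts ->
        \tsum_(t1, t2, t3 <- cop3 ts) t2 ⊗ (R1 P t1 * R2 P t3)
          = ts ⊗ (1 : H) + (1 : A) ⊗ qQ2 P ts ->
        exists i : aug_quot I -> aug A,
        [/\ forall h : aug H, aug_val (i (aug_pi I h)) =
              \tsum_(t1, t2, t3 <- cop3 ts)
                (pair P h t2 *: (t1 * antip t3)) - (pair P h ts)%:A,
            augmented_by X i &
            forall a : A, lie_derivative w i a =
              \tsum_(a1, a2 <- cop a) (qQ P a1 ts *: a2)
              - \tsum_(a1, a2 <- cop a) (qQ P a2 ts *: a1)]].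
Proof.
(* Regularity only asserts that a tensor exists for each [h]; [choice] collects them into a
   function. *)
have /choice[D DP] := regular_aug regP.
exists (quot_crossed P I D) => w; split.
- exact: quot_induced.
- exact: quot_crossed_module.
- exact: quot_calculus.
- exact: quot_inner.
move=> ts tsI tsE; exists (fun x : aug_quot I => quot_aug_map P ts x); split.
- by move=> h; rewrite quot_aug_mapE.
- exact: quot_augmented.
- exact: quot_lie_derivative.
Qed.
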